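(* Let $n\ge 1$ and let $\Omega$ be any nonempty open set in $\mathbb{R}^n$ with $|\Omega|<\infty$. Let $\sigma\in(0,1)$ and $p\in(0,\infty)$. Then there exists a nonnegative $u\in C^\infty_c(\Omega)$ such that $$\iint_{\Omega\times\Omega}\frac{|u(x)-u(y)|^p}{|x-y|^{n+\sigma p}}\,dx\,dy<\iint_{\Omega^*\times\Omega^*}\frac{|u^*(x)-u^*(y)|^p}{|x-y|^{n+\sigma p}}\,dx\,dy,$$ where $\Omega^*$ is the symmetric rearrangement of $\Omega$ and $u^*$ is the symmetric decreasing rearrangement of $u$.
   Context: $|A|$ denotes the Lebesgue measure of $A\subset\mathbb{R}^n$, and $\alpha_n=\pi^{n/2}/\Gamma(\frac n2+1)$ is the volume of the unit ball of $\mathbb{R}^n$. For a Borel set $A\subset\mathbb{R}^n$ with $|A|<\infty$, its symmetric rearrangement is the open ball $A^*=\{x\in\mathbb{R}^n: |x|<(|A|/\alpha_n)^{1/n}\}$ (with $A^*=\varnothing$ if $|A|=0$). $\chi_E$ denotes the indicator function of $E$, with $\chi_\varnothing\equiv 0$. For a Borel measurable $u:\mathbb{R}^n\to\mathbb{R}$ such that $|\{|u|>t\}|<\infty$ for all $t>0$, its symmetric decreasing rearrangement is $$u^*(x)=\int_0^\infty\chi_{\{|u|>t\}^*}(x)\,dt.$$ $C_c^\infty(\Omega)$ is the space of smooth real-valued functions with compact support in $\Omega$; such functions are extended by zero to all of $\mathbb{R}^n$. *)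

(* Defs.v *)
From HB Require Import structures.
From mathcomp Require Import all_boot all_order all_algebra.
From mathcomp Require Import all_classical all_reals all_analysis.
From mathcomp Require Import measurable_realfun.

Set Implicit Arguments.
Unset Strict Implicit.
Unset Printing Implicit Defensive.

Import Order.TTheory GRing.Theory Num.Theory.
Import numFieldNormedType.Exports.

Local Open Scope classical_set_scope.
Local Open Scope ring_scope.

(* R^n is 'rV[R]_n with the topology of the library. The library's norm on it
   is the sup norm, which defines the same topology; the Euclidean norm is
   [enorm] below. *)

Fact borel_rV_display : measure_display.
Proof. exact: default_measure_display. Qed.

(* The Borel sigma-algebra of R^n. *)
Section borel_rV.
Context (R : realType) (n : nat).

Definition borel_rV : set (set 'rV[R]_n) := <<s @open 'rV[R]_n >>.

Let borel_rV0 : borel_rV set0.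
Proof. exact: sigma_algebra0. Qed.

Let borel_rVC A : borel_rV A -> borel_rV (~` A).
Proof. exact: sigma_algebraC. Qed.

Let borel_rV_bigcup (F : _^nat) :
  (forall i, borel_rV (F i)) -> borel_rV (\bigcup_i (F i)).
Proof. exact: sigma_algebra_bigcup. Qed.

HB.instance Definition _ := @isMeasurable.Build borel_rV_display
  'rV[R]_n borel_rV borel_rV0 borel_rVC borel_rV_bigcup.

Lemma open_measurable_rV (A : set 'rV[R]_n) : open A -> measurable A.
Proof. by move=> oA; apply: sub_sigma_algebra. Qed.

End borel_rV.

(* Lebesgue measure on R^n, by induction on n: the unit mass on the one-point
   space R^0, and the image of the product measure of R x R^n under the
   identification R x R^n ~ R^(n+1). *)
Section cons_rV.
Context (R : realType) (n : nat).

Definition cons_rV (z : R * 'rV[R]_n) : 'rV[R]_n.+1 :=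
  row_mx (const_mx z.1 : 'rV[R]_1) z.2.

Definition uncons_rV (x : 'rV[R]_n.+1) : R * 'rV[R]_n :=
  (x ord0 ord0, \row_j x ord0 (lift ord0 j)).

Lemma cons_rV0 z : cons_rV z ord0 ord0 = z.1.
Proof. by rewrite /cons_rV mxE; case: splitP => // k; rewrite mxE. Qed.

Lemma cons_rVS z j : cons_rV z ord0 (lift ord0 j) = z.2 ord0 j.
Proof.
rewrite /cons_rV mxE; case: splitP => [k|k [jk]]; first by rewrite ord1.
by congr (z.2 _ _); apply/val_inj.
Qed.

Lemma cons_rVK : cancel cons_rV uncons_rV.
Proof.
move=> z; rewrite /uncons_rV cons_rV0 [RHS]surjective_pairing; congr pair.
by apply/rowP => j; rewrite mxE cons_rVS.
Qed.

Lemma uncons_rVK : cancel uncons_rV cons_rV.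
Proof.
move=> x; apply/rowP => j; case: (unliftP ord0 j) => [k ->|->].
  by rewrite cons_rVS mxE.
by rewrite cons_rV0.
Qed.

Lemma continuous_lift_rV :
  continuous (fun x : 'rV[R]_n.+1 => \row_j x ord0 (lift ord0 j) : 'rV[R]_n).
Proof.
move=> x A [P Pn PA].
exists (fun i j => if unlift ord0 j is Some k then P ord0 k else setT).
  move=> i j; case: unliftP => [k ->|_]; last exact: filterT.
  by have := Pn ord0 k; rewrite mxE [i]ord1.
move=> y Py; apply: PA => i j; rewrite mxE ord1.
by have := Py ord0 (lift ord0 j); rewrite liftK.
Qed.

Lemma measurable_uncons_rV : measurable_fun setT uncons_rV.
Proof.
apply: measurable_fun_pair.
- apply: (measurability _ (RGenOpens.measurableE R)) => _ [_ [a [b ->]] <-].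
  rewrite setTI; apply: open_measurable_rV.
  apply: open_comp => [x _|]; last exact: interval_open.
  exact: coord_continuous.
- apply: (measurability (@open 'rV[R]_n)) => // _ [A oA <-].
  rewrite setTI; apply: open_measurable_rV.
  by apply: open_comp => // x _; exact: continuous_lift_rV.
Qed.

Lemma measurable_cons_rV : measurable_fun setT cons_rV.
Proof.
apply: (measurability (@open 'rV[R]_n.+1)) => // _ [U oU <-].
rewrite setTI.
pose box (q : 'rV[rat]_n.+1 * nat) : set 'rV[R]_n.+1 :=
  ball (map_mx ratr q.1 : 'rV[R]_n.+1) q.2.+1%:R^-1.
pose F q := if `[< box q `<=` U >] then cons_rV @^-1` box q else set0.
suff -> : cons_rV @^-1` U = \bigcup_q F q.
  apply: countable_bigcupT_measurable => [|q]; first exact: countableP.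
  rewrite /F; case: ifP => // _.
  rewrite (_ : _ @^-1` _ =
      ball (ratr (q.1 ord0 ord0) : R) q.2.+1%:R^-1 `*`
      ball (\row_j ratr (q.1 ord0 (lift ord0 j)) : 'rV[R]_n) q.2.+1%:R^-1).
    apply: measurableX; first exact: measurable_ball.
    by apply: open_measurable_rV; exact: ball_open.
  apply/seteqP; split => z.
    move=> [e0 bz]; split => /=.
      by have := bz ord0 ord0; rewrite mxE cons_rV0.
    split => // i j; have := bz ord0 (lift ord0 j).
    by rewrite cons_rVS !mxE [i]ord1.
  move=> [/= b1 [e0 b2]]; split => // i j; rewrite [i]ord1 mxE.
  case: (unliftP ord0 j) => [k ->|->]; last by rewrite cons_rV0.
  by rewrite cons_rVS; have := b2 ord0 k; rewrite mxE.
apply/seteqP; split => [z Uz|z [q _]]; last first.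
  by rewrite /F; case: ifPn => // /asboolP + bz; exact.
have /nbhs_ballP[e /= e0 eU] : nbhs (cons_rV z) U by exact: open_nbhs_nbhs.
have [k ke] : exists k : nat, k.+1%:R^-1 < e / 2.
  have [k _ ke] := near_infty_natSinv_lt (PosNum (divr_gt0 e0 (ltr0n R 2))).
  by exists k; exact: (ke k (leqnn k)).
have k0 : 0 < k.+1%:R^-1 :> R by rewrite invr_gt0.
have /choice[q qP] : forall j, exists q : rat,
    `|ratr q - cons_rV z ord0 j| < k.+1%:R^-1.
  move=> j.
  have [|q] := @rat_in_itvoo R (cons_rV z ord0 j - k.+1%:R^-1)
    (cons_rV z ord0 j + k.+1%:R^-1).
    by rewrite ltrD2l gtrN.
  by rewrite in_itv/= -ltr_distlC distrC => ?; exists q.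
exists (\row_j q j, k) => //.
have cz : box (\row_j q j, k) (cons_rV z).
  split => // i j; rewrite [i]ord1 [map_mx _ _ _ _]mxE [(\row_j q j) _ _]mxE.
  exact: qP.
rewrite /F asboolT// => y by_; apply: eU; rewrite [e]splitr.
pose c : 'rV[R]_n.+1 := map_mx ratr (\row_j q j).
apply: (@ball_triangle _ _ c).
  by apply/ball_sym; apply: le_ball cz; exact: ltW.
by apply: le_ball by_; exact: ltW.
Qed.

End cons_rV.

Section lebesgue_rV_step.
Context (R : realType) (n : nat).
Variable mu : {sigma_finite_measure set 'rV[R]_n -> \bar R}.
Local Open Scope ereal_scope.

Definition lebesgue_rV_step : set 'rV[R]_n.+1 -> \bar R :=
  pushforward (lebesgue_measure \x mu) (@cons_rV R n).

Let step0 : lebesgue_rV_step set0 = 0.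
Proof. by rewrite /lebesgue_rV_step /pushforward preimage_set0 measure0. Qed.

Let step_ge0 A : 0 <= lebesgue_rV_step A.
Proof. exact: (measure_ge0 (lebesgue_measure \x mu)). Qed.

Let step_sigma_additive : semi_sigma_additive lebesgue_rV_step.
Proof.
move=> F mF tF mUF; rewrite /lebesgue_rV_step /pushforward preimage_bigcup.
have mcons A : measurable A -> measurable (@cons_rV R n @^-1` A).
  by move=> mA; rewrite -[X in measurable X]setTI; exact: measurable_cons_rV.
apply: measure_semi_sigma_additive => [k||]; first exact: mcons.
- apply/trivIsetP => i j _ _ ij; rewrite -preimage_setI.
  by move/trivIsetP : tF => /(_ _ _ _ _ ij) ->//; rewrite preimage_set0.
- by rewrite -preimage_bigcup; exact: mcons.
Qed.

HB.instance Definition _ := isMeasure.Build _ _ _ lebesgue_rV_step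
  step0 step_ge0 step_sigma_additive.

Let step_sigma_finite : sigma_finite setT lebesgue_rV_step.
Proof.
have /sigma_finiteP[F [FT ndF Foo]] := sigma_finiteT (@lebesgue_measure R).
have /sigma_finiteP[G [GT ndG Goo]] := sigma_finiteT mu.
exists (fun k => @uncons_rV R n @^-1` (F k `*` G k)).
  rewrite -preimage_bigcup -[LHS](preimage_setT (@uncons_rV R n)).
  congr (_ @^-1` _); rewrite -setXTT FT GT; apply/seteqP; split => -[x y].
    move=> [/= [i _ Fix] [j _ Gjy]]; exists (maxn i j) => //; split.
    - by move: x Fix; exact/subsetPset/ndF/leq_maxl.
    - by move: y Gjy; exact/subsetPset/ndG/leq_maxr.
  by move=> [i _ []/= ? ?]; split; exists i.
move=> k; have [mF Fk] := Foo k; have [mG Gk] := Goo k; split.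
  rewrite -[X in measurable X]setTI; apply: measurable_uncons_rV => //.
  exact: measurableX.
rewrite /lebesgue_rV_step /pushforward -comp_preimage.
rewrite (_ : _ \o _ = id); last by apply/funext => z; exact: cons_rVK.
by rewrite preimage_id product_measure1E// lte_mul_pinfty// ge0_fin_numE.
Qed.

HB.instance Definition _ := Measure_isSigmaFinite.Build _ _ _ lebesgue_rV_step
  step_sigma_finite.

End lebesgue_rV_step.

Fixpoint lebesgue_rV (R : realType) (n : nat) :
    {sigma_finite_measure set 'rV[R]_n -> \bar R} :=
  if n is n'.+1 then lebesgue_rV_step (lebesgue_rV R n')
  else \d_(0 : 'rV[R]_0).

(* The rectangles determine [lebesgue_rV]. *)
Lemma lebesgue_rV_cons (R : realType) n (A : set R) (B : set 'rV[R]_n) :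
  measurable A -> measurable B ->
  lebesgue_rV R n.+1 [set x | A (x ord0 ord0) /\
                              B (\row_j x ord0 (lift ord0 j))] =
  (lebesgue_measure A * lebesgue_rV R n B)%E.
Proof.
move=> mA mB; rewrite -product_measure1E//; congr product_measure1.
by apply/seteqP; split => -[a b]; rewrite /= cons_rV0;
  have := cons_rVK (a, b) => -[_ ->].
Qed.

Definition enorm (R : realType) (n : nat) (x : 'rV[R]_n) : R :=
  Num.sqrt (\sum_i x ord0 i ^+ 2).

Definition Gamma (R : realType) (s : R) : R :=
  \int[lebesgue_measure]_(t in `]0, +oo[) (t `^ (s - 1) * expR (- t)).

Definition alpha (R : realType) (n : nat) : R :=
  pi `^ (n%:R / 2) / Gamma (n%:R / 2 + 1).

(* Meaningful for measurable [A] of finite measure only. Since [0 `^ n%:R^-1]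
   is [0] for [n > 0], the rearrangement of a null set is empty. *)
Definition sym_rearr (R : realType) (n : nat) (A : set 'rV[R]_n) :
    set 'rV[R]_n :=
  [set x | enorm x < (fine (lebesgue_rV R n A) / alpha R n) `^ n%:R^-1].

(* The layer-cake integral may be infinite at the origin when [u] is
   unbounded, hence the extended codomain. *)
Definition sym_decr_rearr (R : realType) (n : nat) (u : 'rV[R]_n -> R)
    (x : 'rV[R]_n) : \bar R :=
  (\int[lebesgue_measure]_(t in `]0%R, +oo[)
     (\1_(sym_rearr [set y | (t < `|u y|)%R]) x)%:E)%E.

Definition partial (R : realType) (n : nat) (i : 'I_n) (u : 'rV[R]_n -> R) :
    'rV[R]_n -> R :=
  'D_(delta_mx ord0 i) u.

(* All partial derivatives of order at most [k] exist and are continuous. *)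
Fixpoint Ck (R : realType) (n k : nat) (u : 'rV[R]_n -> R) : Prop :=
  continuous u /\
  if k is k'.+1 then
    forall i : 'I_n, (forall x, derivable u x (delta_mx ord0 i)) /\ Ck k' (partial i u)
  else True.

Definition smooth (R : realType) (n : nat) (u : 'rV[R]_n -> R) : Prop :=
  forall k, Ck k u.

Definition closed_support (R : realType) (n : nat) (u : 'rV[R]_n -> R) :
    set 'rV[R]_n :=
  closure [set x | u x != 0].

(* C_c^oo(Omega), its elements being extended by zero to R^n. *)
Definition Ccoo (R : realType) (n : nat) (Omega : set 'rV[R]_n) :
    set ('rV[R]_n -> R) :=
  [set u | [/\ smooth u, compact (closed_support u) &
    closed_support u `<=` Omega]].

(* The integrand is [0] on the diagonal, as [x / 0 = 0]. *)
Definition gagliardo (R : realType) (n : nat) (sigma p : R)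
    (Omega : set 'rV[R]_n) (u : 'rV[R]_n -> R) : \bar R :=
  (\int[lebesgue_rV R n \x lebesgue_rV R n]_(z in Omega `*` Omega)
     (`|u z.1 - u z.2| `^ p / enorm (z.1 - z.2) `^ (n%:R + sigma * p))%:E)%E.

(* Main.v *)
(** For [u] supported in a small ball, the Gagliardo integral over [Omega] is
    the one over [R^n] minus [2 \int u^p(x) \int_(~Omega) |x - y|^(-n-sigma p)].
    Take [u] a radial smooth bump around [c] in [Omega]: then [u^*] is the same
    bump centred at the origin, and only the second term changes. Among the sets
    of given volume the inner integral at [c] is smallest for the ball around
    [c], strictly so when [Omega] misses a part of positive measure of that ball.
    Such a [c] exists, since two distinct balls of radius [r] cannot both fill
    [Omega] up to null sets; a small enough bump keeps the inequality strict.
    The terms to be subtracted are finite since the bump is Lipschitz, and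
    [alpha n] is the volume of the unit ball by a layer-cake computation of the
    Gaussian integral. *)

(* The integral over R^n is never formed. Translate Omega to O so that the bump sits at the origin,
   and let B be the centred ball of the same volume, of radius r. Both double integrals are compared
   with the one over the square of the intersection of O and B, which is finite and cancels. What O
   x O adds to it is at most, and what B x B adds is at least, twice the integral of u^p times the
   integral of a weight carried by O \ B, respectively B \ O. These two differences have the same
   mass. Points of O \ B are at distance at least r - e from the points where the bump of radius e
   is positive, while points of B \ O are only known to be within r + e, which alone would give the
   wrong inequality. Hence the radius r' < r: a part of B \ O of positive mass lies in the ball of
   radius r', where the distance is at most r' + e. Since r' is fixed before e, the gain r'^(-s) -
   r^(-s) on that part, with s = n + sigma p, survives as e tends to 0, while the loss on the rest
   vanishes. Only pointwise bounds on the kernel enter, never convexity of t^p, so p < 1 is treated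
   like p >= 1. *)
Require Import Defs.
From HB Require Import structures.
From mathcomp Require Import all_boot all_order all_algebra.
From mathcomp Require Import all_classical all_reals all_analysis.
From mathcomp Require Import measurable_realfun ring lra.

Import Order.TTheory GRing.Theory Num.Theory.
Import numFieldNormedType.Exports.

Local Open Scope classical_set_scope.
Local Open Scope ring_scope.

Set Implicit Arguments.
Unset Strict Implicit.
Unset Printing Implicit Defensive.

(** * Euclidean norm *)

Section enorm.
Context {R : realType} {n : nat}.
Implicit Types x y z : 'rV[R]_n.

Lemma sqr_enorm x : enorm x ^+ 2 = \sum_i x ord0 i ^+ 2.
Proof. by rewrite sqr_sqrtr// sumr_ge0// => i _; exact: sqr_ge0. Qed.

Lemma enorm_ge0 x : 0 <= enorm x.
Proof. exact: sqrtr_ge0. Qed.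

Lemma enorm0 : enorm (0 : 'rV[R]_n) = 0.
Proof.
by rewrite /enorm big1 ?sqrtr0// => i _; rewrite mxE expr0n.
Qed.

Lemma enormZ (a : R) x : enorm (a *: x) = `|a| * enorm x.
Proof.
rewrite /enorm -[X in X * _]sqrtr_sqr -sqrtrM ?sqr_ge0// mulr_sumr.
by congr Num.sqrt; apply: eq_bigr => i _; rewrite mxE exprMn.
Qed.

Lemma enormN x : enorm (- x) = enorm x.
Proof. by rewrite -scaleN1r enormZ normrN1 mul1r. Qed.

Lemma enormBC x y : enorm (x - y) = enorm (y - x).
Proof. by rewrite -enormN opprB. Qed.

Lemma coord_le_enorm x i : `|x ord0 i| <= enorm x.
Proof.
rewrite -sqrtr_sqr ler_wsqrtr// (bigD1 i)//= lerDl sumr_ge0// => j _.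
exact: sqr_ge0.
Qed.

Lemma enorm_eq0 x : enorm x = 0 -> x = 0.
Proof.
move=> x0; apply/rowP => i; apply/eqP; rewrite mxE -normr_le0 -x0.
exact: coord_le_enorm.
Qed.

Lemma Cauchy_Schwarz_enorm x y :
  `|\sum_i x ord0 i * y ord0 i| <= enorm x * enorm y.
Proof.
have [/enorm_eq0 ->|y0] := eqVneq (enorm y) 0.
  rewrite enorm0 mulr0 big1 ?normr0// => i _.
  by rewrite mxE mulr0.
set d := \sum_i _.
rewrite -[leRHS]ger0_norm ?mulr_ge0 ?enorm_ge0// -ler_sqr ?nnegrE//.
rewrite -!normrX !ger0_norm ?sqr_ge0// exprMn.
(* The vector is |y|^2 times the component of x orthogonal to y, which avoids dividing by |y|^2. *)
have : 0 <= \sum_i (enorm y ^+ 2 * x ord0 i - d * y ord0 i) ^+ 2.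
  by rewrite sumr_ge0// => i _; exact: sqr_ge0.
have -> : \sum_i (enorm y ^+ 2 * x ord0 i - d * y ord0 i) ^+ 2 =
    enorm y ^+ 2 * (enorm y ^+ 2 * enorm x ^+ 2 - d ^+ 2).
  transitivity (\sum_i (enorm y ^+ 4 * (x ord0 i ^+ 2) +
    (d ^+ 2 * y ord0 i ^+ 2 - enorm y ^+ 2 * d *+ 2 * (x ord0 i * y ord0 i)))).
    by apply: eq_bigr => i _; ring.
  rewrite big_split/= big_split/= sumrN -!mulr_sumr -!sqr_enorm -/d; ring.
rewrite pmulr_rge0 ?exprn_even_gt0//= => h; lra.
Qed.

Lemma enorm_triangle x y : enorm (x + y) <= enorm x + enorm y.
Proof.
rewrite -ler_sqr ?nnegrE ?addr_ge0 ?enorm_ge0//.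
have -> : enorm (x + y) ^+ 2 =
    enorm x ^+ 2 + enorm y ^+ 2 + (\sum_i x ord0 i * y ord0 i) *+ 2.
  rewrite !sqr_enorm -sumrMnl -!big_split/=; apply: eq_bigr => i _.
  by rewrite mxE; ring.
have := Cauchy_Schwarz_enorm x y; have := ler_norm (\sum_i x ord0 i * y ord0 i).
by move=> h1 h2; nra.
Qed.

End enorm.

(** * Lebesgue integration on R^n *)

Section measurability_rV.
Context {R : realType} {n : nat}.

Lemma measurable_fun_to_rV d (T : measurableType d) (f : T -> 'rV[R]_n) :
  (forall U, open U -> measurable (f @^-1` U)) -> measurable_fun setT f.
Proof.
move=> mf; apply: (measurability (@open 'rV[R]_n)) => // _ [A oA <-].
by rewrite setTI; exact: mf.
Qed.

Lemma measurable_continuous_rV (f : 'rV[R]_n -> R) :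
  continuous f -> measurable_fun setT f.
Proof.
move=> cf; apply: (measurability _ (RGenOpens.measurableE R)).
move=> _ [_ [a [b ->]] <-]; rewrite setTI; apply: open_measurable_rV.
by apply: open_comp => [x _|]; [exact: cf|exact: interval_open].
Qed.

Lemma measurable_coord_rV i : measurable_fun setT (fun x : 'rV[R]_n => x ord0 i).
Proof. by apply: measurable_continuous_rV => x; exact: coord_continuous. Qed.

Lemma continuous_enorm : continuous (@enorm R n).
Proof.
have sqc i : continuous (fun y : 'rV[R]_n => y ord0 i ^+ 2).
  move=> y; apply: (@continuous_comp _ _ _ (fun y : 'rV[R]_n => y ord0 i)
    (fun t : R => t ^+ 2)); first exact: coord_continuous.
  exact: exprn_continuous.
have sumc : continuous (fun y : 'rV[R]_n => \sum_i y ord0 i ^+ 2).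
  by apply: continuous_big => [|i _]; [exact: add_continuous|exact: sqc].
by move=> x; apply: continuous_comp; [exact: sumc|exact: sqrt_continuous].
Qed.

Lemma measurable_enorm : measurable_fun setT (@enorm R n).
Proof. exact: measurable_continuous_rV continuous_enorm. Qed.

Lemma measurable_enormB : measurable_fun setT
  (fun z : 'rV[R]_n * 'rV[R]_n => enorm (z.1 - z.2)).
Proof.
apply: (measurableT_comp (continuous_measurable_fun (@sqrt_continuous R))).
apply: measurable_sum => i; apply: measurable_funX.
under eq_fun do rewrite !mxE.
apply: measurable_funB.
  by apply: (measurableT_comp (measurable_coord_rV i)); exact: measurable_fst.
by apply: (measurableT_comp (measurable_coord_rV i)); exact: measurable_snd.
Qed.

Lemma continuous_to_rV (T : topologicalType) (f : T -> 'rV[R]_n) :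
  (forall i, continuous (fun x => f x ord0 i)) -> continuous f.
Proof.
move=> cf x A [P Pn PA].
apply: (@filterS _ _ _ [set y | forall j, P ord0 j (f y ord0 j)]).
  by move=> y Py; apply: PA => i j; rewrite ord1.
by apply: filter_forall => j; exact: cf (Pn ord0 j).
Qed.

Lemma continuous_affine_rV (a : R) (c : 'rV[R]_n) :
  continuous (fun x : 'rV[R]_n => a *: x + c).
Proof.
apply: continuous_to_rV => i.
rewrite [X in continuous X](_ : _ =
  (fun y : 'rV[R]_n => a * y ord0 i + c ord0 i)); last first.
  by apply/funext => y; rewrite !mxE.
move=> x; have FF : Filter (nbhs x) by exact: nbhs_filter.
apply: (@cvgD _ R^o _ (nbhs x)); last exact: cvg_cst.
by apply: (@cvgM _ _ (nbhs x)); [exact: cvg_cst|exact: coord_continuous].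
Qed.

Lemma measurable_affine_rV (a : R) (c : 'rV[R]_n) :
  measurable_fun setT (fun x : 'rV[R]_n => a *: x + c).
Proof.
apply: measurable_fun_to_rV => U oU; apply: open_measurable_rV.
by apply: open_comp => // x _; exact: continuous_affine_rV.
Qed.

End measurability_rV.

(** * Affine changes of variables and Tonelli in coordinates *)

Section integral_rV.
Context {R : realType}.
Local Open Scope ereal_scope.
Notation mu := (@lebesgue_measure R).

(** By uniqueness of Lebesgue measure: [a] times the image of Lebesgue measure under x -> a x + c
    gives every half-open interval its length. *)
Lemma ge0_integral_affine (a c : R) (f : R -> \bar R) : (0 < a)%R ->
  measurable_fun setT f -> (forall x, 0 <= f x) ->
  a%:E * \int[mu]_x f (a * x + c)%R = \int[mu]_x f x.
Proof.
move=> a0 mf f0.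
pose phi : measurableTypeR R -> measurableTypeR R := fun x => (a * x + c)%R.
have mphi : measurable_fun setT phi.
  by apply: measurable_funD => //; exact: mulrl_measurable.
have [m mE] : exists m : {measure set (measurableTypeR R) -> \bar R},
    m = pushforward mu phi :> (set _ -> _).
  by unshelve refine (ex_intro _ (pushforward mu phi : {measure set _ -> \bar R}) _).
have muE (A : set R) : measurable A -> mscale (NngNum (ltW a0)) m A = mu A.
  move=> mA; apply/esym/lebesgue_measure_unique => //= _ [[x y]] _ <-.
  rewrite /mscale /= mE /pushforward.
  rewrite (_ : phi @^-1` _ = `](x - c) / a, (y - c) / a]%classic)%R; last first.
    apply/seteqP; split => z; rewrite /= !in_itv/= ltr_pdivrMr// ler_pdivlMr//.
      by rewrite /phi ltrBlDr lerBrDr ![(z * a)%R]mulrC.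
    by rewrite /phi ltrBlDr lerBrDr ![(z * a)%R]mulrC.
  rewrite !lebesgue_measure_itv/= !lte_fin ltr_pM2r ?invr_gt0// ltrD2r.
  case: ifPn => _; last by rewrite mule0.
  rewrite -!EFinB -EFinM; congr EFin; field; exact: lt0r_neq0.
transitivity (\int[mscale (NngNum (ltW a0)) m]_x f x).
  by rewrite ge0_integral_mscale//= mE ge0_integral_pushforward.
by apply: eq_measure_integral => A mA _; exact: muE.
Qed.

Lemma ge0_integral_rVS n (f : 'rV[R]_n.+1 -> \bar R) :
  measurable_fun setT f -> (forall x, 0 <= f x) ->
  \int[lebesgue_rV R n.+1]_x f x =
  \int[mu]_a \int[lebesgue_rV R n]_b f (cons_rV (a, b)).
Proof.
move=> mf f0.
have mfc : measurable_fun setT (f \o @cons_rV R n).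
  by apply: measurableT_comp => //; exact: measurable_cons_rV.
transitivity (\int[mu \x lebesgue_rV R n]_z (f \o @cons_rV R n) z).
  have mc : @measurable_fun _ _ (measurableTypeR R * 'rV[R]_n)%type _ setT
    (@cons_rV R n) by exact: measurable_cons_rV.
  exact: (ge0_integral_pushforward mc (mu \x lebesgue_rV R n) measurableT mf
    (fun x _ => f0 x)).
rewrite fubini_tonelli1// => x; exact: f0.
Qed.

(** Scaling and translation act on each coordinate separately, so they commute with splitting off
    the first one; each induction step costs one factor [a]. *)
Lemma ge0_integral_affine_rV n (a : R) (c : 'rV[R]_n) (f : 'rV[R]_n -> \bar R) :
  (0 < a)%R -> measurable_fun setT f -> (forall x, 0 <= f x) ->
  (a ^+ n)%:E * \int[lebesgue_rV R n]_x f (a *: x + c)%R =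
  \int[lebesgue_rV R n]_x f x.
Proof.
move=> a0; elim: n c f => [|n IH] c f mf f0.
  rewrite expr0 mul1e; apply: eq_integral => x _; congr f.
  by apply/rowP; case.
rewrite ge0_integral_rVS//=; last first.
  by apply: measurableT_comp => //; exact: measurable_affine_rV.
have consE s b : (a *: cons_rV (s, b) + c =
    cons_rV (a * s + (uncons_rV c).1, a *: b + (uncons_rV c).2) :> 'rV[R]_n.+1)%R.
  apply/rowP => j; rewrite [LHS]mxE [X in (X + _)%R = _]mxE.
  by case: (unliftP ord0 j) => [k ->|->]; rewrite ?cons_rVS ?cons_rV0 ?mxE.
under eq_integral do under eq_integral do rewrite consE.
rewrite exprS EFinM -muleA.
have mcons : measurable_fun setT (f \o @cons_rV R n).
  by apply: measurableT_comp => //; exact: measurable_cons_rV.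
have mf2 s : measurable_fun setT (fun b => f (cons_rV (s, b))).
  by apply: (measurableT_comp mcons) => //; exact: pair1_measurable.
pose F s := \int[lebesgue_rV R n]_b f (cons_rV (s, b)).
have mF : measurable_fun setT F.
  by apply: (measurable_fun_fubini_tonelli_F (f \o @cons_rV R n)) => // x; exact: f0.
have F0 s : 0 <= F s by apply: integral_ge0.
transitivity (a%:E * \int[mu]_s F (a * s + (uncons_rV c).1)%R).
  rewrite -ge0_integralZl//; last 3 first.
  - apply: (@measurable_fun_fubini_tonelli_F _ _ _ _ _ (lebesgue_rV R n)
      (fun z => f (cons_rV (a * z.1 + (uncons_rV c).1,
                            a *: z.2 + (uncons_rV c).2)%R))) => //.
    apply: (measurableT_comp mcons); apply: measurable_fun_pair => /=.
      apply: measurable_funD => //; apply: measurable_funM => //.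
    by apply: (measurableT_comp (measurable_affine_rV a _)); exact: measurable_snd.
  - by move=> x _; exact: integral_ge0.
  - by rewrite lee_fin exprn_ge0// ltW.
  congr (_ * _); apply: eq_integral => s _.
  by rewrite (IH (uncons_rV c).2 (fun b => f (cons_rV (a * s + (uncons_rV c).1, b)%R))).
by rewrite (ge0_integral_affine _ a0 mF)// ge0_integral_rVS.
Qed.

End integral_rV.

(** * Volume of balls *)

(** Turns a domain into a factor of the integrand, because Tonelli and the changes of variables are
    applied on whole spaces. *)
Lemma integral_mul_indic d (T : measurableType d) (R : realType)
    (m : {measure set T -> \bar R}) (D : set T) (f : T -> R) :
  (\int[m]_x (f x * \1_D x)%:E = \int[m]_(x in D) (f x)%:E)%E.
Proof.
rewrite [RHS]integral_mkcond; apply: eq_integral => x _.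
by rewrite patchE indicE; case: ifPn => _; rewrite ?mulr1 ?mulr0.
Qed.

Section lebesgue_rV_affine.
Context {R : realType} {n : nat}.
Notation lam := (lebesgue_rV R n).

Lemma measurable_preimage_affine_rV (a : R) (c : 'rV[R]_n) (A : set 'rV[R]_n) :
  measurable A -> measurable ((fun x => a *: x + c) @^-1` A).
Proof.
by move=> mA; rewrite -[X in measurable X]setTI; exact: measurable_affine_rV.
Qed.

Lemma measurable_preimage_shift_rV (c : 'rV[R]_n) (A : set 'rV[R]_n) :
  measurable A -> measurable ((fun x => x + c) @^-1` A).
Proof.
move=> /(measurable_preimage_affine_rV 1 c).
by under [X in X @^-1` A]eq_fun do rewrite scale1r.
Qed.

Lemma lebesgue_rV_affine (a : R) (c : 'rV[R]_n) (A : set 'rV[R]_n) :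
  0 < a -> measurable A ->
  ((a ^+ n)%:E * lam ((fun x => (a *: x + c)%R) @^-1` A) = lam A)%E.
Proof.
move=> a0 mA; rewrite -[X in _ = lam X]setIT -[X in (_ * lam X)%E]setIT.
have mpA := measurable_preimage_affine_rV a c mA.
rewrite -!integral_indic//.
pose f (x : 'rV[R]_n) : \bar R := (\1_A x)%:E.
have mf : measurable_fun setT f by apply/measurable_EFinP; exact: measurable_indic.
have f0 x : (0 <= f x)%E by rewrite lee_fin.
exact: (ge0_integral_affine_rV c a0 mf f0).
Qed.

Lemma lebesgue_rV_shift (c : 'rV[R]_n) (A : set 'rV[R]_n) :
  measurable A -> lam ((fun x => x + c) @^-1` A) = lam A.
Proof.
move=> mA; rewrite -(lebesgue_rV_affine c ltr01 mA) expr1n mul1e.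
by congr (lam _); apply/seteqP; split => x /=; rewrite scale1r.
Qed.

End lebesgue_rV_affine.

Lemma measurable_cube (R : realType) (n : nat) (e : R) :
  measurable [set x : 'rV[R]_n | forall i, `|x ord0 i| < e].
Proof.
rewrite (_ : [set x | _] = \bigcap_i [set x : 'rV[R]_n | `|x ord0 i| < e]).
  apply: fin_bigcap_measurable => // i _; rewrite -[X in measurable X]setTI.
  apply: (measurable_fun_ltr _ _ measurableT) => //.
  by apply: measurableT_comp => //; exact: measurable_coord_rV.
by apply/seteqP; split => x /= h i *; exact: h.
Qed.

(** Cubes are the sets whose volume the product structure gives at once; they bound the unit ball
    from above and open sets from below. *)
Lemma lebesgue_rV_cube (R : realType) (n : nat) (e : R) : 0 < e ->
  lebesgue_rV R n [set x | forall i, `|x ord0 i| < e] = ((e *+ 2) ^+ n)%:E.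
Proof.
move=> e0; elim: n => [|n IH].
  by rewrite /= diracE mem_set//= => -[].
rewrite exprS EFinM -IH.
rewrite (_ : (e *+ 2)%:E = lebesgue_measure `]-e, e[%classic); last first.
  by rewrite lebesgue_measure_itv/= lte_fin gtrN// -EFinB opprK.
rewrite -lebesgue_rV_cons//.
  congr (lebesgue_rV R n.+1 _); apply/seteqP; split => x /=.
    move=> xe; split => [|i]; last by rewrite mxE.
    by rewrite in_itv/= -ltr_norml.
  rewrite in_itv/= -ltr_norml => -[x0 xS] i.
  by case: (unliftP ord0 i) => [k ->|->//]; have := xS k; rewrite mxE.
exact: measurable_cube.
Qed.

Section eball.
Context {R : realType} {n : nat}.
Notation lam := (lebesgue_rV R n).

Definition eball (r : R) : set 'rV[R]_n := [set x | enorm x < r].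

Lemma open_eball r : open (eball r).
Proof.
rewrite (_ : eball r = (@enorm R n) @^-1` `]-oo, r[%classic).
  by apply: open_comp => [x _|]; [exact: continuous_enorm|exact: interval_open].
by apply/seteqP; split => x /=; rewrite in_itv.
Qed.

Lemma measurable_eball r : measurable (eball r).
Proof. by apply: open_measurable_rV; exact: open_eball. Qed.

Lemma lebesgue_rV_eball_scale (r : R) : 0 < r ->
  (lam (eball r) = (r ^+ n)%:E * lam (eball 1))%E.
Proof.
move=> r0; rewrite -(lebesgue_rV_affine 0 r0 (measurable_eball r)).
congr (_ * lam _)%E; apply/seteqP; split => x; rewrite /eball /= addr0.
  by rewrite enormZ gtr0_norm// -[X in _ < X -> _]mulr1 ltr_pM2l.
by rewrite enormZ gtr0_norm// -[X in _ -> _ < X]mulr1 ltr_pM2l.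
Qed.

Lemma lebesgue_rV_eball1_ltoo : (lam (eball 1) < +oo)%E.
Proof.
apply: (@le_lt_trans _ _ (lam [set x | forall i, `|x ord0 i| < 1])); last first.
  by rewrite lebesgue_rV_cube// ltry.
apply: le_measure; rewrite ?inE; [exact: measurable_eball|exact: measurable_cube|].
by move=> x x1 i; apply: le_lt_trans x1; exact: coord_le_enorm.
Qed.

Lemma lebesgue_rV_open_gt0 (U : set 'rV[R]_n) : open U -> U !=set0 -> (0 < lam U)%E.
Proof.
move=> oU [c Uc].
have /nbhs_ballP[e /= e0 eU] : nbhs c U by exact: open_nbhs_nbhs.
apply: (@lt_le_trans _ _ (lam [set x | forall i, `|x ord0 i| < e])).
  by rewrite lebesgue_rV_cube// lte_fin exprn_gt0// mulrn_wgt0.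
rewrite -(lebesgue_rV_shift c (open_measurable_rV oU)).
apply: le_measure; rewrite ?inE; first exact: measurable_cube.
  exact: measurable_preimage_shift_rV (open_measurable_rV oU).
move=> x xe; apply: eU; split => // i j; rewrite [i]ord1 mxE.
by rewrite /ball /= opprD addrA addrAC subrr add0r normrN.
Qed.

Lemma lebesgue_rV_eball1_gt0 : (0 < lam (eball 1))%E.
Proof.
apply: lebesgue_rV_open_gt0; first exact: open_eball.
by exists 0; rewrite /eball /= enorm0.
Qed.

End eball.

(** * Gaussian integral and the volume of the unit ball *)

Lemma integral_expRN (R : realType) (c : R) :
  (\int[lebesgue_measure]_(t in `]c, +oo[) (expR (- t))%:E = (expR (- c))%:E)%E.
Proof.
have cE : continuous (fun t : R => expR (- t)).
  by move=> t; apply: continuous_comp; [exact: opp_continuous|exact: continuous_expR].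
have dE (x : R) : is_derive x 1 (fun t : R => - expR (- t)) (expR (- x)).
  apply: is_derive_eq. by rewrite !mulrN1 opprK.
rewrite integral_itv_obnd_cbnd; last first.
  apply/measurable_EFinP; apply: measurable_funTS.
  exact: continuous_measurable_fun.
rewrite (@ge0_continuous_FTC2y _ _ (fun t => - expR (- t)) _ 0).
- by rewrite -EFinB sub0r opprK.
- by move=> x _; exact: expR_ge0.
- exact: continuous_subspaceT.
- by rewrite -oppr0; apply: cvgN; exact: cvgr_expR.
- by move=> x _; have [] := dE x.
- by apply: cvg_at_right_filter; apply: cvgN; exact: cE.
- by move=> x _; rewrite derive1E; have [] := dE x.
Qed.

Lemma integral_gauss_rV (R : realType) (n : nat) :
  (\int[lebesgue_rV R n]_x (expR (- enorm x ^+ 2))%:E = (Num.sqrt pi ^+ n)%:E)%E.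
Proof.
have mg m : measurable_fun setT (fun x : 'rV[R]_m => (expR (- enorm x ^+ 2))%:E).
  apply/measurable_EFinP; apply: measurableT_comp => //.
  apply: measurableT_comp => //; apply: measurable_funX; exact: measurable_enorm.
elim: n => [|n IH].
  rewrite integral_dirac//; last exact: mg.
  by rewrite [X in (X * _)%E]diracT mul1e enorm0 expr0n oppr0 expR0.
rewrite ge0_integral_rVS//.
have E (a : R) (b : 'rV[R]_n) : expR (- enorm (cons_rV (a, b)) ^+ 2) =
    gauss_fun a * expR (- enorm b ^+ 2).
  rewrite /gauss_fun -expRD -opprD !sqr_enorm big_ord_recl cons_rV0.
  by congr (expR (- (_ + _))); apply: eq_bigr => i _; rewrite cons_rVS.
transitivity (\int[lebesgue_measure]_a
  ((gauss_fun (a : R))%:E * (Num.sqrt pi ^+ n)%:E))%E.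
  apply: eq_integral => a _; rewrite -IH -ge0_integralZl//.
  - by apply: eq_integral => b _; rewrite E EFinM.
  - exact: mg.
  - by rewrite lee_fin gauss_fun_ge0.
rewrite ge0_integralZr//.
- by rewrite integralT_gauss -EFinM exprS.
- by apply/measurable_EFinP; exact: measurable_gauss_fun.
- by move=> x _; rewrite lee_fin gauss_fun_ge0.
Qed.

Section alpha.
Context {R : realType} {n : nat}.
Notation lam := (lebesgue_rV R n).

(* Both sides are the integral of [exp (- |x| ^ 2)]. *)
Lemma gauss_layer_cake :
  (\int[lebesgue_measure]_(t in `]0%R, +oo[) (t `^ (n%:R / 2) * expR (- t))%:E *
   lam (eball 1) = (Num.sqrt pi ^+ n)%:E)%E.
Proof.
rewrite -integral_gauss_rV.
(* exp(-|x|^2) is the integral of exp(-t) over t > |x|^2. Integrating in x first leaves exp(-t)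
   times the volume of the ball of radius sqrt t, which is t^(n/2) times that of the unit ball. *)
pose G (z : 'rV[R]_n * R) : R := expR (- z.2) * \1_(`]enorm z.1 ^+ 2, +oo[%classic) z.2.
have mG : measurable_fun setT (EFin \o G).
  apply/measurable_EFinP; apply: measurable_funM.
    apply: measurableT_comp => //; apply: measurableT_comp => //.
  rewrite (_ : (fun z => _) = \1_[set z : 'rV[R]_n * R | enorm z.1 ^+ 2 < z.2]).
    apply: measurable_indic; rewrite -[X in measurable X]setTI.
    apply: (measurable_fun_ltr _ _ measurableT) => //.
    apply: measurable_funX; apply: (measurableT_comp measurable_enorm).
    exact: measurable_fst.
  apply/funext => z; rewrite !indicE; congr ((_ : bool)%:R).
  by apply/idP/idP; rewrite !inE/= in_itv/= andbT.
have G0 z : (0 <= (EFin \o G) z)%E by rewrite lee_fin mulr_ge0// expR_ge0.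
transitivity (\int[lam]_x \int[lebesgue_measure]_t (G (x, t))%:E)%E; last first.
  by apply: eq_integral => x _; rewrite -integral_expRN -[RHS]integral_mul_indic.
transitivity (\int[lebesgue_measure]_t \int[lam]_x (G (x, t))%:E)%E; last first.
  exact/esym/(@fubini_tonelli _ _ _ _ R lam (@lebesgue_measure R) (EFin \o G)).
rewrite muleC -ge0_integralZl//; last 2 first.
- apply/measurable_EFinP; apply: measurable_funTS; apply: measurable_funM.
    exact: measurable_powR.
  by apply: measurableT_comp => //; exact: measurableT_comp.
- by move=> t _; rewrite lee_fin mulr_ge0// ?expR_ge0 ?powR_ge0.
rewrite integral_mkcond; apply: eq_integral => t _; rewrite patchE.
rewrite (_ : (fun x => _) = (fun x => (expR (- t))%:E *
    (\1_[set x : 'rV[R]_n | (enorm x ^+ 2 < t)%R] x)%:E)%E); last first.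
  apply/funext => x; rewrite /= /G -EFinM; congr ((_ * _)%:E).
  by rewrite !indicE; congr ((_ : bool)%:R); apply/idP/idP; rewrite !inE/= in_itv/= andbT.
have [t0|t0] := ltP 0 t; last first.
  rewrite memNset; last by rewrite /= in_itv/= andbT; apply/negP; rewrite -leNgt.
  rewrite integral0_eq// => x _; rewrite indicE memNset ?mule0//=.
  by apply/negP; rewrite -leNgt (le_trans t0) ?sqr_ge0.
rewrite mem_set; last by rewrite /= in_itv/= andbT.
have sE : [set x : 'rV[R]_n | enorm x ^+ 2 < t] = eball (Num.sqrt t).
  apply: eq_set => x; rewrite -{1}(sqr_sqrtr (ltW t0)).
  by rewrite ltr_pXn2r// nnegrE ?enorm_ge0 ?sqrtr_ge0.
have mI : measurable_fun setT
    (fun x : 'rV[R]_n => (\1_(eball (Num.sqrt t)) x)%:E : \bar R).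
  by apply/measurable_EFinP; apply: measurable_indic; exact: measurable_eball.
rewrite sE ge0_integralZl ?lee_fin ?expR_ge0//.
rewrite integral_indic//; last exact: measurable_eball.
rewrite setIT [X in _ = (_ * X)%E]lebesgue_rV_eball_scale ?sqrtr_gt0// EFinM.
rewrite (_ : t `^ (n%:R / 2) = Num.sqrt t ^+ n); last first.
  by rewrite mulrC powRrM powR12_sqrt ?ltW// powR_mulrn ?sqrtr_ge0.
by rewrite [RHS]muleA [RHS]muleC; congr (_ * _)%E; rewrite muleC.
Qed.

Lemma lebesgue_rV_eball1 : lam (eball 1) = (alpha R n)%:E.
Proof.
have w_fin : lam (eball 1) \is a fin_num.
  by rewrite ge0_fin_numE//; exact: lebesgue_rV_eball1_ltoo.
have w_gt0 := @lebesgue_rV_eball1_gt0 R n.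
have := gauss_layer_cake.
rewrite -(fineK w_fin); move: w_gt0; rewrite -{1}(fineK w_fin) lte_fin.
set w := fine _ => w0.
set I := (\int[_]_(t in _) _)%E => IE.
have I0 : (0 <= I)%E.
  by apply: integral_ge0 => t _; rewrite lee_fin mulr_ge0// ?powR_ge0 ?expR_ge0.
have spi : 0 < Num.sqrt (pi : R) ^+ n by rewrite exprn_gt0// sqrtr_gt0 pi_gt0.
(* [Gamma] is the real part [fine] of an extended integral, so [I] must be known to be finite before
   it can be identified with it: an infinite [I] times the positive volume could not be a power of
   sqrt pi. *)
have I_fin : I \is a fin_num.
  rewrite ge0_fin_numE// ltey; apply/eqP => Ioo; move: IE; rewrite Ioo.
  by rewrite gt0_mulye// lte_fin.
rewrite /alpha /Gamma /Rintegral.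
have -> : (\int[lebesgue_measure]_(t in `]0%R, +oo[)
    (t `^ (n%:R / 2 + 1 - 1) * expR (- t))%:E)%E = I.
  by apply: eq_integral => t _; rewrite addrK.
rewrite (_ : pi `^ (n%:R / 2) = Num.sqrt pi ^+ n); last first.
  by rewrite mulrC powRrM powR12_sqrt ?pi_ge0// powR_mulrn ?sqrtr_ge0.
move: IE; rewrite -(fineK I_fin) -EFinM => -[IE].
congr EFin; rewrite -IE [fine I * w]mulrC mulfK//.
by apply/eqP => I00; move: IE spi; rewrite I00 mul0r => <-; rewrite ltxx.
Qed.

Lemma alpha_gt0 : 0 < alpha R n.
Proof. by rewrite -lte_fin -lebesgue_rV_eball1 lebesgue_rV_eball1_gt0. Qed.

(** In dimension 0 the formula would fail at [r = 0], where the ball is empty while [r ^+ 0] is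
    1. *)
Lemma lebesgue_rV_eball (r : R) : (0 < n)%N -> 0 <= r ->
  lam (eball r) = (alpha R n * r ^+ n)%:E.
Proof.
move=> n0; rewrite le_eqVlt => /predU1P[<-|r0]; last first.
  by rewrite lebesgue_rV_eball_scale// [X in (_ * X)%E]lebesgue_rV_eball1 -EFinM mulrC.
rewrite expr0n gtn_eqF// mulr0 (_ : eball 0 = set0) ?measure0//.
by apply/seteqP; split => // x; rewrite /eball/= ltNge enorm_ge0.
Qed.

Lemma sym_rearr_eball (A : set 'rV[R]_n) (r : R) : (0 < n)%N -> 0 <= r ->
  lam A = lam (eball r) -> sym_rearr A = eball r.
Proof.
move=> n0 r0 Ar; rewrite /sym_rearr Ar lebesgue_rV_eball//=.
have a0 := alpha_gt0.
rewrite mulrAC divff ?gt_eqF// mul1r -powR_mulrn// -powRrM divff ?powRr1//.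
by rewrite pnatr_eq0 -lt0n.
Qed.

End alpha.

(** * Bump functions *)

Section flat.
Context {R : realType}.
Implicit Types (m : nat) (t : R).

(* The derivatives of [t |-> exp (- 1 / t)] are combinations of the [flat m]. *)
Definition flat m t : R := if 0 < t then expR (- t^-1) / t ^+ m else 0.

Lemma flat_ge0 m t : 0 <= flat m t.
Proof.
by rewrite /flat; case: ifPn => // t0; rewrite divr_ge0 ?expR_ge0// exprn_ge0// ltW.
Qed.

Lemma flat_gt0 m t : (0 < flat m t) = (0 < t).
Proof.
rewrite /flat; case: ifPn => [t0|]; last by rewrite ltxx.
by rewrite divr_gt0 ?expR_gt0// exprn_gt0.
Qed.

(* From [exp s >= (s / k) ^ k] with [k = m + j] and [s = 1 / t]. *)
Lemma flat_le m j t : 0 <= t -> flat m t <= (m + j)%:R ^+ (m + j) * t ^+ j.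
Proof.
rewrite le_eqVlt /flat => /predU1P[<-|t0].
  by rewrite ltxx mulr_ge0 ?exprn_ge0.
rewrite t0 ler_pdivrMr ?exprn_gt0// -mulrA -exprD [(j + m)%N]addnC -exprMn.
have [->|k0] := posnP (m + j); first by rewrite expr0 expR_le1 oppr_le0 invr_ge0 ltW.
rewrite expRN -[leRHS]invrK lef_pV2 ?posrE ?expR_gt0 ?invr_gt0 ?exprn_gt0
  ?mulr_gt0 ?ltr0n//.
have -> : t^-1 = (m + j)%:R * ((m + j)%:R * t)^-1.
  by rewrite invfM mulrA divff ?mul1r// pnatr_eq0 -lt0n.
rewrite expRM_natl -exprVn lerXn2r ?nnegrE ?invr_ge0 ?expR_ge0//.
  by rewrite mulr_ge0// ltW.
by apply: le_trans (expR_ge1Dx _); rewrite lerDr.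
Qed.

Lemma flat0_le1 t : flat 0 t <= 1.
Proof.
have [t0|t0] := leP 0 t; last by rewrite /flat ltNge (ltW t0)/= ler01.
by have := flat_le 0 0 t0; rewrite !expr0 mulr1.
Qed.

Lemma is_derive_flat m t :
  is_derive t 1 (flat m) (flat m.+2 t - m%:R * flat m.+1 t).
Proof.
have [t0|t0|<-] := ltgtP 0 t.
- have fE : \near t, expR (- t^-1) / t ^+ m = flat m t.
    near=> x; rewrite /flat ifT//; near: x; exact: lt_nbhsr.
  apply: (near_eq_is_derive fE).
  have tn0 : t != 0 by rewrite gt_eqF.
  have dV : is_derive t 1 (fun x : R => x^-1) (- t ^- 2).
    apply: DeriveDef; first exact: (@derivableV _ _ id).
    by rewrite (@deriveV _ _ id)// derive_id; exact: mulr1.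
  have dE : is_derive t 1 (fun x : R => expR (- x^-1)) (expR (- t^-1) * t ^- 2).
    have := @is_derive1_comp _ expR (fun x : R => - x^-1) t _ _
      (is_derive_expR _) (is_deriveN dV).
    by rewrite opprK.
  have := is_deriveM dE (is_deriveX m dV).
  rewrite /flat t0; set d := (d in is_derive _ _ _ d).
  rewrite (_ : _ * _ = (fun x : R => expR (- x^-1) / x ^+ m)); last first.
    by apply/funext => x; rewrite !fctE -exprVn.
  move=> dM; apply: is_derive_eq; rewrite /d.
  rewrite !fctE /GRing.scale/= -!exprVn.
  case: m {d dM fE} => [|k]; first by rewrite !expr0; ring.
  by rewrite /= !exprS; ring.
- have fE : \near t, cst 0 t = flat m t.
    near=> x; rewrite /flat ltNge ltW//; near: x; exact: lt_nbhsl.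
  apply: (near_eq_is_derive fE).
  by rewrite /flat !ltNge (ltW t0)/= mulr0 subrr; exact: is_derive_cst.
- rewrite /flat ltxx mulr0 subrr -/(flat m).
  (* At the origin, [flat_le] with [j = 2] bounds the difference quotient by a constant times
     |h|. *)
  have L : h^-1 *: (flat m (h *: 1 + 0) - flat m 0) @[h --> 0^'] --> (0 : R).
    apply/cvgr0Pnorm_le => e e0; near=> h.
    have -> : flat m 0 = 0 by rewrite /flat ltxx.
    rewrite subr0 addr0 [h *: 1]mulr1 normrZ normfV.
    rewrite ler_pdivrMl ?normr_gt0; last by near: h; exact: nbhs_dnbhs_neq.
    rewrite ger0_norm ?flat_ge0//.
    apply: (@le_trans _ _ ((m + 2)%:R ^+ (m + 2) * `|h| ^+ 2)).
      have [h0|h0] := ltP 0 h; last first.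
        by rewrite /flat ltNge h0 mulr_ge0 ?exprn_ge0.
      by rewrite ger0_norm ?(ltW h0)// flat_le// ltW.
    have k0 : 0 < (m + 2)%:R ^+ (m + 2) :> R by rewrite exprn_gt0// ltr0n addn2.
    rewrite expr2 mulrCA ler_wpM2l// mulrC -ler_pdivlMr//.
    by near: h; apply: dnbhs0_le; rewrite divr_gt0.
  by apply: DeriveDef; [apply/cvg_ex; exists 0|apply: cvg_lim].
Unshelve. all: by end_near. Qed.

Lemma continuous_flat m : continuous (flat m).
Proof.
move=> t; apply/differentiable_continuous/derivable1_diffP.
by have [] := is_derive_flat m t.
Qed.

Lemma flat_lipschitz : exists2 L : R, 0 <= L &
  forall s t, `|flat 0 s - flat 0 t| <= L * `|s - t|.
Proof.
(* 4 = 2 ^ 2 bounds the derivative [flat 2], by [flat_le] with [j = 0]. *)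
exists 4 => // s t; wlog st : s t / s <= t => [hw|].
  by have [/hw//|/ltW/hw] := leP s t; rewrite distrC [`|t - s|]distrC.
move: st; rewrite le_eqVlt => /predU1P[->|st]; first by rewrite !subrr normr0 mulr0.
rewrite distrC [`|s - t|]distrC.
have [c _ ->] := MVT st (fun x _ => is_derive_flat 0 x)
  (continuous_subspaceT (@continuous_flat 0)).
rewrite normrM mul0r subr0 ger0_norm ?flat_ge0// ler_wpM2r//.
have [c0|c0] := leP 0 c; last by rewrite /flat ltNge (ltW c0)/= ler0n.
by have := flat_le 2 0 c0; rewrite addn0 expr0 mulr1 -natrX.
Qed.

End flat.

(** * Closure properties of [Ck] *)

Section Ck_closure.
Context {R : realType} {n : nat}.
Implicit Types (f g : 'rV[R]_n -> R).

Lemma Ck_continuous k f : Ck k f -> continuous f.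
Proof. by case: k => [[]|k []]. Qed.

Lemma CkW k f : Ck k.+1 f -> Ck k f.
Proof.
elim: k f => [|k IH] f [cf df]; first by split.
by split=> // i; have [? ?] := df i; split=> //; exact: IH.
Qed.

Lemma Ck_cst k (a : R) : Ck k (fun _ : 'rV[R]_n => a).
Proof.
elim: k a => [|k IH] a; split => //; [exact: cst_continuous|exact: cst_continuous|].
move=> i; split => [x|]; first exact: derivable_cst.
rewrite (_ : partial i _ = fun=> 0) //.
by apply/funext => x; exact: derive_cst.
Qed.

Lemma is_derive_coord (x v : 'rV[R]_n) j :
  is_derive x v (fun y : 'rV[R]_n => y ord0 j) (v ord0 j).
Proof.
have L : h^-1 *: ((h *: v + x) ord0 j - x ord0 j) @[h --> 0^'] --> (v ord0 j : R).
  apply: cvg_near_cst; near=> h.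
  rewrite !mxE addrK /GRing.scale/= mulrA mulVf ?mul1r//.
  near: h; exact: nbhs_dnbhs_neq.
by apply: DeriveDef; [apply/cvg_ex; exists (v ord0 j)|apply: cvg_lim].
Unshelve. all: by end_near. Qed.

Lemma Ck_coord k (j : 'I_n) : Ck k (fun x : 'rV[R]_n => x ord0 j).
Proof.
case: k => [|k]; split => //; try exact: coord_continuous.
move=> i; split => [x|]; first by have [] := is_derive_coord x (delta_mx ord0 i) j.
rewrite (_ : partial i _ = fun=> (delta_mx ord0 i : 'rV[R]_n) ord0 j).
  exact: Ck_cst.
by apply/funext => x; have [] := is_derive_coord x (delta_mx ord0 i) j.
Qed.

Lemma CkD k f g : Ck k f -> Ck k g -> Ck k (fun x => f x + g x).
Proof.
elim: k f g => [|k IH] f g [cf df] [cg dg]; split => //.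
- by move=> x; apply: (cvgD (cf x) (cg x)).
- by move=> x; apply: (cvgD (cf x) (cg x)).
move=> i; have [dfi Cf] := df i; have [dgi Cg] := dg i.
split => [x|]; first exact: derivableD.
rewrite (_ : partial i _ = fun x => partial i f x + partial i g x); first exact: IH.
by apply/funext => x; exact: deriveD.
Qed.

Lemma CkM k f g : Ck k f -> Ck k g -> Ck k (fun x => f x * g x).
Proof.
elim: k f g => [|k IH] f g Cf0 Cg0.
  by split => // x; apply: (continuousM (Ck_continuous Cf0 (x := x)) (Ck_continuous Cg0 (x := x))).
have [cf df] := Cf0; have [cg dg] := Cg0; split.
  by move=> x; apply: (continuousM (cf x) (cg x)).
move=> i; have [dfi Cf] := df i; have [dgi Cg] := dg i.
split => [x|]; first exact: derivableM.
rewrite (_ : partial i _ = fun x => f x * partial i g x + g x * partial i f x).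
  by apply: CkD; apply: IH => //; exact: CkW.
by apply/funext => x; exact: deriveM.
Qed.

Lemma Ck_sum k (I : Type) (r : seq I) (F : I -> 'rV[R]_n -> R) :
  (forall i, Ck k (F i)) -> Ck k (fun x => \sum_(i <- r) F i x).
Proof.
move=> CF; elim: r => [|i r IH].
  by under eq_fun do rewrite big_nil; exact: Ck_cst.
by under eq_fun do rewrite big_cons; exact: CkD.
Qed.

(** The chain rule replaces [flat m] by [flat m.+2] and [flat m.+1], hence an induction on [k] for
    all [m] at once. That rule is the one for Frechet derivatives, whence the separate hypothesis of
    differentiability, [Ck] speaking only of partial derivatives. *)
Lemma Ck_flat_comp k m (q : 'rV[R]_n -> R) :
  (forall x, differentiable q x) -> (forall k, Ck k q) -> Ck k (flat m \o q).
Proof.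
move=> dq Cq; elim: k m => [|k IH] m; split => //.
- by move=> x; apply: continuous_comp;
    [exact: (Ck_continuous (Cq 0%N))|exact: continuous_flat].
- by move=> x; apply: continuous_comp;
    [exact: (Ck_continuous (Cq 0%N))|exact: continuous_flat].
move=> i.
have dflat (t : R) : differentiable (flat m) t.
  by apply/derivable1_diffP; have [] := is_derive_flat m t.
have D x : differentiable (flat m \o q) x by exact: differentiable_comp.
split => [x|]; first exact: diff_derivable.
rewrite (_ : partial i _ = fun x =>
  ((flat m.+2 \o q) x + - m%:R * (flat m.+1 \o q) x) * partial i q x).
  apply: CkM; last by have [_ /(_ i)[]] := Cq k.+1.
  by apply: CkD => //; apply: CkM => //; exact: Ck_cst.
apply/funext => x; rewrite /partial deriveE// diff_comp//=.
rewrite deriv1E; last exact/derivable1_diffP.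
have [_ dfE] := is_derive_flat m (q x).
by rewrite derive1E dfE mulNr -deriveE// [RHS]mulrC.
Qed.

End Ck_closure.

(** * The radial bump, its support, Lipschitz bound and rearrangement *)

Section bump.
Context {R : realType} {n : nat}.
Implicit Types (e : R) (c x y : 'rV[R]_n).

(** The usual mollifier exp(-1 / (e^2 - |x|^2)). The argument of [flat 0] is polynomial in the
    coordinates, so smoothness holds at the centre too. *)
Definition bump e x : R := flat 0 (e ^+ 2 - enorm x ^+ 2).

Lemma bump_ge0 e x : 0 <= bump e x.
Proof. exact: flat_ge0. Qed.

Lemma bump_gt0 e x : 0 <= e -> (0 < bump e x) = (enorm x < e).
Proof.
by move=> e0; rewrite flat_gt0 subr_gt0 ltr_pXn2r// nnegrE enorm_ge0.
Qed.

Lemma bump_eq0 e x : 0 <= e -> e <= enorm x -> bump e x = 0.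
Proof.
by move=> e0; rewrite leNgt -bump_gt0// lt0r bump_ge0 andbT negbK => /eqP.
Qed.

Lemma continuous_bump e : continuous (bump e).
Proof.
have cn : continuous (fun x : 'rV[R]_n => enorm x ^+ 2).
  move=> x; apply: (@continuous_comp _ _ _ (@enorm R n) (fun t : R => t ^+ 2)).
    exact: continuous_enorm.
  exact: exprn_continuous.
have cq : continuous (fun x : 'rV[R]_n => e ^+ 2 - enorm x ^+ 2).
  by move=> x; apply: (@continuousB _ _ _ (fun=> e ^+ 2) _ x _ (cn x)); apply: cst_continuous.
by move=> x; apply: (continuous_comp (cq x) (@continuous_flat R 0 _)).
Qed.

Lemma measurable_bump e : measurable_fun setT (bump e).
Proof. exact: (measurable_continuous_rV (@continuous_bump e)). Qed.

Lemma smooth_bump e c : smooth (fun x => bump e (x - c)).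
Proof.
pose q x := e ^+ 2 + \sum_i (-1) * ((x ord0 i + - c ord0 i) * (x ord0 i + - c ord0 i)).
move=> k; rewrite (_ : (fun x => _) = flat 0 \o q); last first.
  apply/funext => x; rewrite /bump /= sqr_enorm /q -sumrN.
  by congr (flat 0 (_ + _)); apply: eq_bigr => i _; rewrite !mxE expr2 mulN1r.
apply: (@Ck_flat_comp R n k 0 q) => [x|{}k].
  apply: differentiableD => //.
  rewrite (_ : (fun x => _) = \sum_i (fun x : 'rV[R]_n =>
      (-1) * ((x ord0 i + - c ord0 i) * (x ord0 i + - c ord0 i)))).
    apply: differentiable_sum => i.
    have dc : differentiable (fun x : 'rV[R]_n => x ord0 i + - c ord0 i) x.
      by apply: differentiableD => //; exact: differentiable_coord.
    by apply: differentiableM => //; exact: differentiableM.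
  by apply/funext => y; rewrite fct_sumE.
apply: CkD; first exact: Ck_cst.
apply: Ck_sum => i; apply: CkM; first exact: Ck_cst.
have Cc : Ck k (fun x : 'rV[R]_n => x ord0 i + - c ord0 i).
  by apply: CkD; [exact: Ck_coord|exact: Ck_cst].
exact: CkM.
Qed.

Lemma closed_support_bump e c : 0 <= e ->
  closed_support (fun x => bump e (x - c)) `<=` [set x | enorm (x - c) <= e].
Proof.
move=> e0; rewrite /closed_support.
have cl : closed [set x | enorm (x - c) <= e].
  rewrite (_ : mkset _ = (fun x => enorm (x - c)) @^-1` [set t | t <= e])//.
  apply: closed_comp => [x _|]; last exact: closed_le.
  apply: (@continuous_comp _ _ _ (fun x => x - c) (@enorm R n)); last exact: continuous_enorm.
  by apply: (@continuousB _ _ _ id (fun=> c)); [exact: cvg_id|exact: cst_continuous].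
rewrite [X in _ `<=` X]((closure_id _).1 cl).
apply: closure_subset => x /=; apply: contra_neqT; rewrite -ltNge => ex.
by rewrite bump_eq0// ltW.
Qed.

Lemma Ccoo_bump e c (Omega : set 'rV[R]_n) : 0 <= e ->
  [set x | enorm (x - c) <= e] `<=` Omega -> Ccoo Omega (fun x => bump e (x - c)).
Proof.
move=> e0 eO; split; first exact: smooth_bump.
  apply: (@subclosed_compact _ _ [set v : 'rV[R]_n | forall i,
      `[c ord0 i - e, c ord0 i + e]%classic (v ord0 i)]).
  - exact: closed_closure.
  - apply: (@rV_compact _ _ (fun i => `[c ord0 i - e, c ord0 i + e]%classic)).
    by move=> i; exact: segment_compact.
  move=> x /(closed_support_bump e0)/= xe i.
  rewrite in_itv/= -ler_distlC distrC; apply: le_trans xe.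
  by have := coord_le_enorm (x - c) i; rewrite !mxE.
exact: subset_trans (closed_support_bump e0) eO.
Qed.

(** On the ball, |y|^2 - |x|^2 = (|y| - |x|)(|y| + |x|) has its second factor at most 2 |r|, and
    [flat 0] is Lipschitz. This controls the singularity of the kernel on the diagonal. *)
Lemma bump_lipschitz e r : exists2 L : R, 0 <= L &
  forall x y, enorm x < r -> enorm y < r ->
    `|bump e x - bump e y| <= L * enorm (x - y).
Proof.
have [L L0 HL] := @flat_lipschitz R.
exists (L * (`|r| *+ 2)) => [|x y xr yr]; first by rewrite mulr_ge0// mulrn_wge0.
apply: (le_trans (HL _ _)); rewrite -mulrA ler_wpM2l//.
have -> : e ^+ 2 - enorm x ^+ 2 - (e ^+ 2 - enorm y ^+ 2) =
  (enorm y - enorm x) * (enorm y + enorm x) by ring.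
rewrite normrM mulrC ler_pM//.
  rewrite ger0_norm ?addr_ge0 ?enorm_ge0// mulr2n.
  by rewrite lerD// (le_trans (ltW _) (ler_norm r)).
have h1 := enorm_triangle y (x - y); have h2 := enorm_triangle x (y - x).
rewrite addrC subrK in h1; rewrite addrC subrK enormBC in h2.
by rewrite ler_norml; apply/andP; split; lra.
Qed.

Lemma bump_superlevel e (t : R) : 0 < t ->
  exists2 rho : R, 0 <= rho & forall x, (t < bump e x) = (enorm x < rho).
Proof.
move=> t0; have [t1|t1] := leP 1 t.
  exists 0 => // x; rewrite [RHS]ltNge enorm_ge0/=; apply/negbTE; rewrite -leNgt.
  by apply: le_trans t1; exact: flat0_le1.
have lt0 : 0 < - ln t by rewrite oppr_gt0 ln_lt0// t0.
have tE (y : R) : (t < flat 0 y) = ((- ln t)^-1 < y).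
  rewrite /flat; case: ifPn => y0; last first.
    apply/idP/idP => [|h]; first by rewrite ltNge ltW.
    by move: y0; rewrite (lt_trans _ h)// invr_gt0.
  rewrite expr0 divr1 -[X in X < _](@lnK R t)//.
  by rewrite ltr_expR ltrNr -[LHS]ltf_pV2 ?posrE ?invr_gt0// invrK.
(* The solution rho of exp(-1 / (e^2 - rho^2)) = t. When the difference is negative, [Num.sqrt]
   returns 0 and the ball is empty, as it should be. *)
exists (Num.sqrt (e ^+ 2 - (- ln t)^-1)) => [|x]; first exact: sqrtr_ge0.
rewrite tE ltrBrDr -ltrBrDl.
have [s0|s0] := leP 0 (e ^+ 2 - (- ln t)^-1).
  by rewrite -{1}(sqr_sqrtr s0) ltr_pXn2r// nnegrE ?enorm_ge0 ?sqrtr_ge0.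
rewrite ltr0_sqrtr// [RHS]ltNge enorm_ge0; apply/negbTE.
by rewrite -leNgt (le_trans (ltW s0))// sqr_ge0.
Qed.

(** Each superlevel set is already a ball, around [c], so rearranging it only moves its centre to
    the origin; the layer-cake integral at [x] is then the length of the interval from 0 to
    [bump e x]. *)
Lemma sym_decr_rearr_bump e c x : (0 < n)%N ->
  sym_decr_rearr (fun x => bump e (x - c)) x = (bump e x)%:E.
Proof.
move=> n0; rewrite /sym_decr_rearr.
transitivity (\int[lebesgue_measure]_(t in `]0%R, +oo[) (\1_`]0%R, bump e x[ t)%:E)%E.
  apply: eq_integral => t; rewrite inE/= in_itv/= andbT => t0.
  have [rho rho0 rhoE] := bump_superlevel e t0.
  rewrite (@sym_rearr_eball _ _ _ rho)//.
    by rewrite !indicE; congr ((_ : bool)%:R%:E); apply/idP/idP;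
      rewrite !inE/= in_itv/= t0 rhoE.
  rewrite -(lebesgue_rV_shift (- c) (measurable_eball rho)).
  congr (lebesgue_rV R n _); apply/seteqP; split => y /=;
    by rewrite ger0_norm ?bump_ge0// rhoE.
rewrite integral_indic// setIidl; last first.
  by move=> t /=; rewrite !in_itv/= => /andP[->].
rewrite [LHS]lebesgue_measure_itv/= lte_fin; case: ifPn => [_|].
  by rewrite -EFinB subr0.
by rewrite -leNgt => b0; congr EFin; apply/eqP; rewrite eq_le bump_ge0 b0.
Qed.

End bump.

(** * Integrability of the Gagliardo kernel *)

Lemma nneseries_geometric_ltoo (R : realType) (C q : R) : 0 <= C -> 0 <= q -> q < 1 ->
  (\sum_(k <oo) (C * q ^+ k)%:E < +oo)%E.
Proof.
move=> C0 q0 q1; apply: (@le_lt_trans _ _ (C / (1 - q))%:E); last exact: ltry.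
apply: lime_le.
  by apply: is_cvg_nneseries => k _ _; rewrite lee_fin mulr_ge0// exprn_ge0.
apply: nearW => k; rewrite sumEFin lee_fin big_mkord.
have d0 : 0 < 1 - q by rewrite subr_gt0.
rewrite ler_pdivlMr// -mulr_sumr -mulrA -[leRHS]mulr1 ler_wpM2l// mulrC.
by rewrite -[1 - q]opprB mulNr -subrX1 opprB lerBlDr lerDl exprn_ge0.
Qed.

Section riesz_kernel.
Context {R : realType} {n : nat}.
Hypothesis n0 : (0 < n)%N.
Notation lam := (lebesgue_rV R n).

Lemma dyadic_shell (rho t : R) : 0 < t -> t < rho ->
  exists k : nat, rho * 2^-1 ^+ k.+1 <= t < rho * 2^-1 ^+ k.
Proof.
move=> t0 tr; have rho0 : 0 < rho by exact: lt_trans tr.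
have ex : exists k : nat, rho * 2^-1 ^+ k.+1 <= t.
  have [k _ /(_ _ (leqnn k)) kt] := near_infty_natSinv_lt (PosNum (divr_gt0 t0 rho0)).
  exists k; rewrite mulrC -ler_pdivlMr//; apply: le_trans (ltW kt).
  rewrite exprVn lef_pV2 ?posrE ?exprn_gt0// -natrX ler_nat.
  by apply: ltnW; exact: ltn_expl.
case: (ex_minnP ex) => k kt kmin; exists k; rewrite kt/=.
case: k kt kmin => [|k] kt kmin; first by rewrite expr0 mulr1.
by rewrite ltNge; apply/negP => /kmin; rewrite ltnn.
Qed.

(* On the dyadic shells the integrand is dominated by a geometric series. *)
Lemma integral_riesz_ltoo (a rho : R) : 0 < a -> 0 < rho ->
  (\int[lam]_(x in eball rho) (enorm x `^ a / enorm x ^+ n)%:E < +oo)%E.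
Proof.
move=> a0 rho0; pose rk k : R := rho * 2^-1 ^+ k.
have rk0 k : 0 < rk k by rewrite mulr_gt0// exprn_gt0.
(* On the shell between [rk k.+1] and [rk k], the numerator is taken at the outer radius and the
   denominator at the inner one. *)
pose c k := rk k `^ a / rk k.+1 ^+ n.
have c0 k : 0 <= c k by rewrite divr_ge0 ?powR_ge0// exprn_ge0// ltW.
pose f k (x : 'rV[R]_n) : R := c k * \1_(eball (rk k)) x.
have f0 k x : (0 <= (f k x)%:E)%E by rewrite lee_fin mulr_ge0.
have mf k : measurable_fun setT (EFin \o f k).
  apply/measurable_EFinP; apply: measurable_funM => //.
  by apply: measurable_indic; exact: measurable_eball.
have K0 (x : 'rV[R]_n) : 0 <= enorm x `^ a / enorm x ^+ n.
  by rewrite divr_ge0 ?powR_ge0// exprn_ge0// enorm_ge0.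
have mK : measurable_fun setT (fun x : 'rV[R]_n => (enorm x `^ a / enorm x ^+ n)%:E).
  apply/measurable_EFinP.
  under eq_fun do rewrite -[_^-1]powR_inv1 ?exprn_ge0 ?enorm_ge0//.
  apply: measurable_funM; apply: (measurableT_comp (measurable_powR _)).
    exact: measurable_enorm.
  by apply: measurable_funX; exact: measurable_enorm.
apply: (@le_lt_trans _ _ (\int[lam]_x \sum_(k <oo) (f k x)%:E)%E).
  rewrite integral_mkcond; apply: ge0_le_integral => //.
  - by move=> x _; rewrite patchE; case: ifPn => // _; rewrite lee_fin.
  - apply/(measurable_restrictT _ (measurable_eball _)); exact: measurable_funTS.
  - apply: (ge0_emeasurable_sum (P := xpredT)) => [k x _ _|k _]; [exact: f0|exact: mf].
  move=> x _; rewrite patchE; case: ifPn => [|_]; last exact: nneseries_ge0.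
  rewrite inE /eball/= => xr.
  have [x0|x0] := eqVneq (enorm x) 0.
    by rewrite x0 expr0n gtn_eqF// invr0 mulr0; exact: nneseries_ge0.
  have x0' : 0 < enorm x by rewrite lt_neqAle eq_sym x0 enorm_ge0.
  have [k /andP[k1 k2]] := dyadic_shell x0' xr.
  have fk : ((enorm x `^ a / enorm x ^+ n)%:E <= (f k x)%:E)%E.
    rewrite lee_fin /f indicE mem_set// mulr1 /c ler_pM ?powR_ge0//.
    - by rewrite invr_ge0 exprn_ge0// enorm_ge0.
    - by apply: ge0_ler_powR; rewrite ?nnegrE ?ltW.
    - by rewrite lef_pV2 ?posrE ?exprn_gt0// lerXn2r// nnegrE ltW.
  apply: (le_trans fk).
  apply: le_trans (nneseries_lim_ge k.+1 (fun i _ _ => f0 i x)).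
  by rewrite big_nat_recr//= leeDr// sume_ge0.
rewrite integral_nneseries//.
(* The volume of the ball of radius [rk k] cancels the denominator up to 2^n, leaving the ratio
   2^(-a), which is below 1 since a > 0. *)
have sE k : (\int[lam]_x (f k x)%:E =
    (alpha R n * rho `^ a * 2 ^+ n * (2^-1 `^ a) ^+ k)%:E)%E.
  under eq_integral do rewrite EFinM.
  rewrite ge0_integralZl ?lee_fin//; last first.
    by apply/measurable_EFinP; apply: measurable_indic; exact: measurable_eball.
  rewrite integral_indic//; last exact: measurable_eball.
  rewrite setIT [X in (_ * X)%E]lebesgue_rV_eball ?ltW// -EFinM; congr EFin.
  have hE : (2^-1 `^ a) ^+ k = (2^-1 ^+ k) `^ a :> R.
    by rewrite -powR_mulrn ?powR_ge0// powRAC powR_mulrn.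
  have h0 : 0 < 2^-1 ^+ k :> R by rewrite exprn_gt0.
  rewrite hE /c {1}/rk powRM ?ltW//.
  have -> : rk k.+1 = rk k / 2 by rewrite /rk exprSr mulrA.
  rewrite expr_div_n; field.
  by rewrite !expf_neq0// gt_eqF.
under eq_eseriesr do rewrite sE.
apply: nneseries_geometric_ltoo.
- by rewrite mulr_ge0 ?exprn_ge0// mulr_ge0 ?powR_ge0// ltW// alpha_gt0.
- exact: powR_ge0.
- rewrite -[ltRHS](_ : 1 `^ a = 1); last by rewrite powR1.
  by apply: (gt0_ltr_powR a0); rewrite ?nnegrE// invf_lt1// ltr1n.
Qed.

End riesz_kernel.

Lemma ge0_integral_prod_mul d1 d2 (T1 : measurableType d1) (T2 : measurableType d2)
    (R : realType) (m1 : {sigma_finite_measure set T1 -> \bar R})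
    (m2 : {sigma_finite_measure set T2 -> \bar R}) (f : T1 -> R) (g : T2 -> R) :
  measurable_fun setT f -> measurable_fun setT g ->
  (forall x, 0 <= f x) -> (forall x, 0 <= g x) ->
  (\int[m1 \x m2]_z (f z.1 * g z.2)%:E =
   \int[m1]_x (f x)%:E * \int[m2]_y (g y)%:E)%E.
Proof.
move=> mf mg f0 g0.
have mfg : measurable_fun setT (fun z : T1 * T2 => (f z.1 * g z.2)%:E).
  apply/measurable_EFinP; apply: measurable_funM.
    exact: (measurableT_comp mf measurable_fst).
  exact: (measurableT_comp mg measurable_snd).
have Ef : measurable_fun setT (EFin \o f) by exact/measurable_EFinP.
have Eg : measurable_fun setT (EFin \o g) by exact/measurable_EFinP.
transitivity (\int[m1]_x \int[m2]_y (f x * g y)%:E)%E.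
  by apply: (fubini_tonelli1 (fun z : T1 * T2 => (f z.1 * g z.2)%:E)) => // z;
    rewrite lee_fin mulr_ge0.
transitivity (\int[m1]_x ((f x)%:E * \int[m2]_y (g y)%:E))%E.
  apply: eq_integral => x _; rewrite -ge0_integralZl//;
    [by move=> y _; rewrite lee_fin|by rewrite lee_fin].
rewrite ge0_integralZr//; first by move=> x _; rewrite lee_fin.
by apply: integral_ge0 => y _; rewrite lee_fin.
Qed.

(** * The kernel: translation and finiteness for Lipschitz functions *)

Section gagliardo_kernel.
Context {R : realType} {n : nat}.
Notation lam := (lebesgue_rV R n).
Implicit Types (v : 'rV[R]_n -> R) (s p : R) (c : 'rV[R]_n).

Lemma measurable_shift_rV c : measurable_fun setT (fun x : 'rV[R]_n => x + c).
Proof. by have := measurable_affine_rV 1 c; under eq_fun do rewrite scale1r. Qed.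

Lemma ge0_integral_shift c (g : 'rV[R]_n -> \bar R) :
  measurable_fun setT g -> (forall x, (0 <= g x)%E) ->
  (\int[lam]_x g (x + c)%R = \int[lam]_x g x)%E.
Proof.
move=> mg g0; rewrite -(ge0_integral_affine_rV c ltr01 mg g0) expr1n mul1e.
by apply: eq_integral => x _; rewrite scale1r.
Qed.

Lemma ge0_integral_shift2 c (f : 'rV[R]_n * 'rV[R]_n -> \bar R) :
  measurable_fun setT f -> (forall z, (0 <= f z)%E) ->
  (\int[lam \x lam]_z f (z.1 + c, z.2 + c)%R = \int[lam \x lam]_z f z)%E.
Proof.
move=> mf f0.
have mc := measurable_shift_rV c.
have mfc : measurable_fun setT (fun z : 'rV[R]_n * 'rV[R]_n => f (z.1 + c, z.2 + c)).
  apply: (measurableT_comp mf); apply: measurable_fun_pair.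
    exact: (measurableT_comp mc measurable_fst).
  exact: (measurableT_comp mc measurable_snd).
rewrite fubini_tonelli1// fubini_tonelli1// /fubini_F/=.
rewrite -(ge0_integral_shift c (g := fun x => \int[lam]_y f (x, y))%E).
- apply: eq_integral => x _; apply: (ge0_integral_shift c (g := fun y => f (x + c, y))) => //.
  by apply: (measurableT_comp mf); exact: pair1_measurable.
- exact: (measurable_fun_fubini_tonelli_F f).
- by move=> x; exact: integral_ge0.
Qed.

Definition gagliardo_kernel s p v (z : 'rV[R]_n * 'rV[R]_n) : R :=
  `|v z.1 - v z.2| `^ p / enorm (z.1 - z.2) `^ s.

Lemma gagliardo_kernel_ge0 s p v z : 0 <= gagliardo_kernel s p v z.
Proof. by rewrite divr_ge0 ?powR_ge0. Qed.

Lemma gagliardo_kernelC s p v x y :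
  gagliardo_kernel s p v (x, y) = gagliardo_kernel s p v (y, x).
Proof. by rewrite /gagliardo_kernel/= distrC enormBC. Qed.

Lemma measurable_gagliardo_kernel s p v :
  measurable_fun setT v -> measurable_fun setT (gagliardo_kernel s p v).
Proof.
move=> mv; apply: measurable_funM.
  apply: (measurableT_comp (measurable_powR _)).
  apply: measurableT_comp => //; apply: measurable_funB.
    exact: (measurableT_comp mv measurable_fst).
  exact: (measurableT_comp mv measurable_snd).
under eq_fun do rewrite -powRN.
by apply: (measurableT_comp (measurable_powR _)); exact: measurable_enormB.
Qed.

Lemma gagliardoE sigma p Omega v : gagliardo sigma p Omega v =
  (\int[lam \x lam]_z
    (gagliardo_kernel (n%:R + sigma * p) p v z * \1_(Omega `*` Omega) z)%:E)%E.
Proof. by rewrite integral_mul_indic. Qed.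

(** Puts the bump at the origin at the cost of translating the domain, so that both sides of the
    final inequality involve the same function. *)
Lemma gagliardo_shift sigma p (Omega : set 'rV[R]_n) v c :
  measurable Omega -> measurable_fun setT v ->
  gagliardo sigma p Omega (fun x => v (x - c)) =
  gagliardo sigma p ((fun x => x + c) @^-1` Omega) v.
Proof.
move=> mO mv; rewrite !gagliardoE.
have mc := measurable_shift_rV (- c).
rewrite -(ge0_integral_shift2 c); last 2 first.
- apply/measurable_EFinP; apply: measurable_funM.
    by apply: measurable_gagliardo_kernel; exact: (measurableT_comp mv mc).
  by apply: measurable_indic; exact: measurableX.
- by move=> z; rewrite lee_fin mulr_ge0// gagliardo_kernel_ge0.
apply: eq_integral => -[x y] _ /=; rewrite !indicE /gagliardo_kernel/=.
rewrite !addrK opprD addrACA subrr addr0; congr (_ * (_ : bool)%:R)%:E.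
Qed.

(** The Lipschitz bound leaves L^p |x - y|^(a - n) with a = p (1 - sigma) > 0, which is integrable
    near the diagonal; boundedness of [E] takes care of the rest. *)
Lemma gagliardo_kernel_integral_ltoo sigma p r L v (E : set 'rV[R]_n) :
  (0 < n)%N -> 0 < sigma -> sigma < 1 -> 0 < p -> 0 < r -> 0 <= L ->
  measurable_fun setT v -> measurable E -> E `<=` eball r ->
  (forall x y, E x -> E y -> `|v x - v y| <= L * enorm (x - y)) ->
  (\int[lam \x lam]_z
    (gagliardo_kernel (n%:R + sigma * p) p v z * \1_(E `*` E) z)%:E < +oo)%E.
Proof.
move=> n0 sg0 sg1 p0 r0 L0 mv mE Er Lip.
pose a := p - sigma * p.
have a0 : 0 < a by rewrite /a -[X in X - _]mul1r -mulrBl mulr_gt0// subr_gt0.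
(* The cutoff at 2 r loses nothing, two points of the ball being less than 2 r apart. The inverse is
   written as a power so that [measurable_powR] applies. *)
pose k (t : R) : R := t `^ a * (t ^+ n) `^ (-1) * \1_(`]-oo, r *+ 2[%classic) t.
have mk : measurable_fun setT k.
  apply: measurable_funM => //; apply: measurable_funM; first exact: measurable_powR.
  exact: (measurableT_comp (measurable_powR _)).
pose K (h : 'rV[R]_n) : R := k (enorm h).
have K0 h : 0 <= K h.
  by rewrite mulr_ge0// mulr_ge0 ?powR_ge0.
have mK : measurable_fun setT K by exact: (measurableT_comp mk measurable_enorm).
pose G (z : 'rV[R]_n * 'rV[R]_n) : R := L `^ p * \1_(eball r) z.1 * K (z.2 - z.1).
have G0 z : 0 <= G z by rewrite mulr_ge0// mulr_ge0// powR_ge0.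
have EG : measurable_fun setT (EFin \o G).
  apply/measurable_EFinP; apply: measurable_funM.
    apply: measurable_funM => //.
    apply: (measurableT_comp _ measurable_fst).
    by apply: measurable_indic; exact: measurable_eball.
  rewrite /K; under eq_fun do rewrite enormBC.
  exact: (measurableT_comp mk measurable_enormB).
apply: (@le_lt_trans _ _ (\int[lam \x lam]_z (G z)%:E)%E).
  apply: ge0_le_integral => //.
  - by move=> z _; rewrite lee_fin mulr_ge0 ?gagliardo_kernel_ge0.
  - apply/measurable_EFinP; apply: measurable_funM.
      exact: measurable_gagliardo_kernel.
    by apply: measurable_indic; exact: measurableX.
  move=> [x y] _; rewrite lee_fin indicE; case: (boolP (_ \in _)); last first.
    by rewrite mulr0.
  rewrite inE => -[/= Ex Ey]; rewrite mulr1.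
  (* On the diagonal the Lipschitz bound forces equal values, and the kernel is 0 because p > 0. *)
  have [xy0|xy0] := eqVneq (enorm (x - y)) 0.
    apply: le_trans (G0 _); rewrite /gagliardo_kernel/=.
    have := Lip x y Ex Ey; rewrite xy0 mulr0 normr_le0 => /eqP ->.
    by rewrite normr0 (@powR0 _ p) ?mul0r// gt_eqF.
  rewrite /G /K /k /= !indicE.
  have [xr yr] := (Er _ Ex, Er _ Ey).
  rewrite !mem_set//=; last first.
    rewrite in_itv/= mulr2n; apply: (le_lt_trans (enorm_triangle _ _)).
    by rewrite enormN ltrD.
  rewrite !mulr1 /gagliardo_kernel/= (enormBC y) powR_inv1 ?exprn_ge0 ?enorm_ge0//.
  have xy_gt0 : 0 < enorm (x - y) by rewrite lt_neqAle eq_sym xy0 enorm_ge0.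
  rewrite powRD ?xy0 ?implybT// powR_mulrn ?(ltW xy_gt0)// /a powRB ?xy0 ?implybT//.
  rewrite invfM [_^-1 * _]mulrC !mulrA ler_wpM2r ?invr_ge0 ?exprn_ge0 ?(ltW xy_gt0)//.
  rewrite ler_wpM2r ?invr_ge0 ?powR_ge0//.
  rewrite -powRM ?enorm_ge0//; apply: ge0_ler_powR; rewrite ?nnegrE ?(ltW p0)//.
    by rewrite mulr_ge0 ?enorm_ge0.
  exact: Lip.
rewrite (fubini_tonelli1 (EFin \o G) EG); last by move=> z; rewrite lee_fin.
pose J := (\int[lam]_h (K h)%:E)%E.
have J0 : (0 <= J)%E by apply: integral_ge0 => h _; rewrite lee_fin.
have Joo : (J < +oo)%E.
  rewrite (_ : J = \int[lam]_(h in eball (r *+ 2)) (enorm h `^ a / enorm h ^+ n)%:E)%E.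
    by apply: integral_riesz_ltoo => //; rewrite mulrn_wgt0.
  rewrite -integral_mul_indic; apply: eq_integral => h _.
  by rewrite /K /k powR_inv1 ?exprn_ge0 ?enorm_ge0// !indicE.
have EK : measurable_fun setT (EFin \o K) by exact/measurable_EFinP.
have c0 x : 0 <= L `^ p * \1_(eball r) x by rewrite mulr_ge0 ?powR_ge0.
have mB : measurable_fun setT (fun x : 'rV[R]_n => (\1_(eball r) x)%:E : \bar R).
  by apply/measurable_EFinP; apply: measurable_indic; exact: measurable_eball.
rewrite (_ : (\int[lam]_x _)%E = (\int[lam]_x ((L `^ p * \1_(eball r) x)%:E * J))%E).
  rewrite ge0_integralZr//; last 2 first.
    by apply/measurable_EFinP; apply: measurable_funM => //; exact/measurable_EFinP.
    by move=> x _; rewrite lee_fin.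
  apply: lte_mul_pinfty => //.
  - by apply: integral_ge0 => x _; rewrite lee_fin.
  - under eq_integral do rewrite EFinM.
    rewrite ge0_integralZl ?lee_fin ?powR_ge0//.
    rewrite integral_indic//; last exact: measurable_eball.
    by rewrite setIT [X in (_ * X)%E]lebesgue_rV_eball ?ltW.
(* Translating by [x] makes the inner integral the same constant [J] for all [x]. *)
apply: eq_integral => x _; rewrite /fubini_F/= /J.
rewrite -(ge0_integral_shift (- x) EK); last by move=> h; rewrite lee_fin.
rewrite -ge0_integralZl ?lee_fin//.
- by apply: (measurableT_comp EK); exact: measurable_shift_rV.
- by move=> y _; rewrite lee_fin.
Qed.

End gagliardo_kernel.

(** * Comparison of the double integrals *)

(** In the application [A] is the translated domain, [B] the ball, [F] the kernel and [w] the p-th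
    power of the bump. The constant [k] bounds the kernel from above between the bump and [A \ B];
    the weight [h] bounds it from below between the bump and [B \ A]. With I the integral over the
    common square and W that of [w], the two sides are separated by I + 2 W k m(A \ B) < I + 2 W
    (integral of [h]). *)
Lemma integral_double_lt d (T : measurableType d) (R : realType)
    (m : {sigma_finite_measure set T -> \bar R}) (F : T * T -> R) (A B : set T)
    (w h : T -> R) (k : R) :
  measurable A -> measurable B ->
  measurable_fun setT F -> measurable_fun setT w -> measurable_fun setT h ->
  (forall z, 0 <= F z) -> (forall x, 0 <= w x) -> (forall x, 0 <= h x) -> 0 <= k ->
  (forall x, ~ B x -> w x = 0) -> (forall x, ~ B x -> h x = 0) ->
  (forall x y, A x -> A y ->
    F (x, y) <= F (x, y) * \1_((A `&` B) `*` (A `&` B)) (x, y) +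
      (k * (w x * \1_(A `\` B) y) + k * (\1_(A `\` B) x * w y))) ->
  (forall x y, B x -> B y ->
    F (x, y) * \1_((A `&` B) `*` (A `&` B)) (x, y) + (w x * h y + h x * w y) <=
      F (x, y)) ->
  (\int[m \x m]_z (F z * \1_((A `&` B) `*` (A `&` B)) z)%:E < +oo)%E ->
  (0 < \int[m]_x (w x)%:E)%E -> (\int[m]_x (w x)%:E < +oo)%E ->
  (k%:E * m (A `\` B) < \int[m]_x (h x)%:E)%E ->
  (\int[m \x m]_z (F z * \1_(A `*` A) z)%:E <
   \int[m \x m]_z (F z * \1_(B `*` B) z)%:E)%E.
Proof.
move=> mA mB mF mw mh F0 w0 h0 k0 wB hB ub lb Ioo W0 Woo kP.
set C := A `&` B; set P := A `\` B.
have mC : measurable C by exact: measurableI.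
have mP : measurable P by exact: measurableD.
have mFI (D : set T) : measurable D ->
    measurable_fun setT (fun z : T * T => (F z * \1_(D `*` D) z)%:E).
  move=> mD; apply/measurable_EFinP; apply: measurable_funM => //.
  by apply: measurable_indic; exact: measurableX.
have FI0 (D : set T) z : (0 <= (F z * \1_(D `*` D) z)%:E)%E by rewrite lee_fin mulr_ge0.
have m12 (f g : T -> R) : measurable_fun setT f -> measurable_fun setT g ->
    measurable_fun setT (fun z : T * T => (f z.1 * g z.2)%:E).
  move=> mf mg; apply/measurable_EFinP; apply: measurable_funM.
    exact: (measurableT_comp mf measurable_fst).
  exact: (measurableT_comp mg measurable_snd).
have mS (g : T -> R) : measurable_fun setT g -> measurable_fun setT
    (fun z : T * T => (F z * \1_(C `*` C) z)%:E +
      ((w z.1 * g z.2)%:E + (g z.1 * w z.2)%:E))%E.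
  move=> mg; apply: (emeasurable_funD (mFI C mC)).
  exact: (emeasurable_funD (m12 w g mw mg) (m12 g w mg mw)).
set W := (\int[m]_x (w x)%:E)%E in W0 Woo *.
set H := (\int[m]_x (h x)%:E)%E in kP *.
set I := (\int[m \x m]_z (F z * \1_(C `*` C) z)%:E)%E in Ioo.
have sumE (g : T -> R) : measurable_fun setT g -> (forall x, 0 <= g x) ->
    (\int[m \x m]_z ((F z * \1_(C `*` C) z)%:E +
      ((w z.1 * g z.2)%:E + (g z.1 * w z.2)%:E)) =
    I + (W * \int[m]_x (g x)%:E + W * \int[m]_x (g x)%:E))%E.
  move=> mg g0.
  have wg0 z : (0 <= (w z.1 * g z.2)%:E)%E by rewrite lee_fin mulr_ge0.
  have gw0 z : (0 <= (g z.1 * w z.2)%:E)%E by rewrite lee_fin mulr_ge0.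
  rewrite ge0_integralD//; [|exact: mFI|by move=> z _; exact: adde_ge0|
    exact: (emeasurable_funD (m12 w g mw mg) (m12 g w mg mw))].
  rewrite ge0_integralD//; [|exact: m12|exact: m12].
  by rewrite !ge0_integral_prod_mul// [X in (_ + (_ + X))%E]muleC.
have Ifin : I \is a fin_num by rewrite ge0_fin_numE//; exact: integral_ge0.
have Wfin : W \is a fin_num by rewrite ge0_fin_numE// ltW.
have m1P : measurable_fun setT (\1_P : T -> R) by exact: measurable_indic.
pose kP1 (x : T) : R := k * \1_P x.
have mkP1 : measurable_fun setT kP1 by exact: measurable_funM.
have kP10 x : 0 <= kP1 x by rewrite mulr_ge0.
have kP1E : (\int[m]_x (kP1 x)%:E = k%:E * m P)%E.
  under eq_integral do rewrite EFinM.
  rewrite ge0_integralZl ?lee_fin//; first by rewrite integral_indic// setIT.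
  exact/measurable_EFinP.
(* Strictness survives because [W] is positive and finite and [I] is finite. *)
have lt1 : (I + (W * \int[m]_x (kP1 x)%:E + W * \int[m]_x (kP1 x)%:E) <
    I + (W * H + W * H))%E.
  rewrite lteD2lE// kP1E.
  have lt2 : (W * (k%:E * m P) < W * H)%E by rewrite lte_pmul2l.
  by apply: lteD.
apply: (le_lt_trans _ (lt_le_trans lt1 _)).
- rewrite -sumE//; apply: ge0_le_integral => //.
  + exact: mFI.
  + exact: (mS kP1 mkP1).
  move=> [x y] _; rewrite -!EFinD lee_fin/=.
  have [xy|xy] := boolP ((x, y) \in A `*` A); last first.
    rewrite [X in _ * X]indicE (negbTE xy) mulr0.
    by rewrite !addr_ge0// mulr_ge0.
  rewrite [X in _ * X <= _]indicE xy mulr1; move: xy; rewrite inE => -[/= Ax Ay].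
  apply: (le_trans (ub x y Ax Ay)); rewrite lerD2l.
  by rewrite /kP1 !mulrA [w x * k]mulrC.
- rewrite -sumE//; apply: ge0_le_integral => //.
  + by move=> z _; apply: adde_ge0 => //; apply: adde_ge0; rewrite lee_fin mulr_ge0.
  + exact: (mS h mh).
  + exact: mFI.
  move=> [x y] _; rewrite -!EFinD lee_fin/=.
  have [xy|xy] := boolP ((x, y) \in B `*` B).
    rewrite [X in _ <= _ * X]indicE xy mulr1; move: xy; rewrite inE => -[/= Bx By].
    exact: lb.
  rewrite [X in _ <= _ * X]indicE (negbTE xy) mulr0.
  rewrite indicE memNset ?mulr0; last first.
    by move=> -[/= [_ Bx] [_ By]]; move/negP: xy; apply; rewrite inE.
  have [Bx|Bx] := pselect (B x); last by rewrite (wB x Bx) (hB x Bx) !mul0r !addr0.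
  have [By|By] := pselect (B y); last by rewrite (wB y By) (hB y By) !mulr0 !addr0.
  by move/negP : xy; case; rewrite inE.
Qed.

(** * Choice of the centre *)

Section geometry.
Context {R : realType} {n : nat}.
Hypothesis n0 : (0 < n)%N.
Notation lam := (lebesgue_rV R n).

Lemma lebesgue_setD_eq (A B : set 'rV[R]_n) : measurable A -> measurable B ->
  lam A = lam B -> (lam A < +oo)%E -> lam (A `\` B) = lam (B `\` A).
Proof.
move=> mA mB AB Aoo.
have mAB : measurable (A `&` B) by exact: measurableI.
have fAB : lam (A `&` B) \is a fin_num.
  rewrite ge0_fin_numE//; apply: le_lt_trans Aoo.
  by apply: le_measure; rewrite ?inE.
have E : (lam (A `\` B) + lam (A `&` B) = lam (B `\` A) + lam (A `&` B))%E.
  transitivity (lam A); first exact/esym/(measureDI lam mA mB).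
  by rewrite AB [in RHS]setIC; exact: (measureDI lam mB mA).
by rewrite -[LHS](addeK _ fAB) [X in (X - _)%E]E addeK.
Qed.

Lemma exists_center_not_ball (Omega : set 'rV[R]_n) (r : R) :
  open Omega -> Omega !=set0 -> 0 < r -> lam Omega = lam (eball r) ->
  exists2 c, Omega c & (0 < lam (eball r `\` (fun x => (x + c)%R) @^-1` Omega))%E.
Proof.
move=> oO [c0 Oc0] r0 Or; apply: contrapT => /forall2NP H.
have mO := open_measurable_rV oO.
have full c : Omega c -> lam (eball r `\` (fun x => x + c) @^-1` Omega) = 0%E.
  move=> Oc; have [//|] := H c; rewrite lt0e => /negP; rewrite negb_and negbK.
  by rewrite measure_ge0 orbF => /eqP.
have /nbhs_ballP[e /= e0 eO] : nbhs c0 Omega by exact: open_nbhs_nbhs.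
(* The second centre is [c0] moved by [dl] along a coordinate axis: [e / 2] keeps it in [Omega], and
   [r] keeps the two balls overlapping. *)
pose i0 := Ordinal n0; pose dl : R := Num.min (e / 2) r.
have dl0 : 0 < dl by rewrite /dl lt_min r0 divr_gt0.
pose d : 'rV[R]_n := delta_mx ord0 i0.
have d1 : enorm d = 1.
  rewrite /enorm (bigD1 i0)//= big1 => [|j ji]; last first.
    by rewrite !mxE eqxx/= (negbTE ji) expr0n.
  by rewrite !mxE !eqxx/= expr1n addr0 sqrtr1.
have Oc1 : Omega (dl *: d + c0).
  apply: eO; split => // i j; rewrite [i]ord1 !mxE eqxx/= /ball/=.
  rewrite opprD addrCA subrr addr0 normrN normrM gtr0_norm//.
  apply: (@le_lt_trans _ _ dl).
    by rewrite ler_piMr ?(ltW dl0)//; case: eqP; rewrite ?normr1 ?normr0.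
  by rewrite /dl gt_min; apply/orP; left; rewrite ltr_pdivrMr// mulr2n mulrDr mulr1 ltrDl.
pose O0 := (fun x => x + c0) @^-1` Omega.
have mO0 : measurable O0 by exact: measurable_preimage_shift_rV.
have lamO0 : lam O0 = lam (eball r) by rewrite /O0 lebesgue_rV_shift.
pose B1 := [set x : 'rV[R]_n | enorm (x - dl *: d) < r].
(* The crescent of the second ball outside the closed first one. It is open, and contains the point
   at distance [r + dl / 2] along the axis, so it has positive mass. *)
pose U := B1 `&` [set x | r < enorm x].
have oU : open U.
  apply: openI.
    rewrite (_ : B1 = (fun x => 1 *: x - dl *: d) @^-1` eball r).
      by apply: open_comp => [x _|]; [exact: continuous_affine_rV|exact: open_eball].
    by apply/seteqP; split => x; rewrite /B1 /eball/= scale1r.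
  rewrite (_ : [set x | _] = (@enorm R n) @^-1` `]r, +oo[%classic).
    by apply: open_comp => [x _|]; [exact: continuous_enorm|exact: interval_open].
  by apply/seteqP; split => x /=; rewrite in_itv/= andbT.
have U0 : (0 < lam U)%E.
  apply: lebesgue_rV_open_gt0 => //.
  exists ((r + dl / 2) *: d); split => /=.
    rewrite /B1/= -scalerBl enormZ d1 mulr1.
    have : dl <= r by rewrite /dl ge_min lexx orbT.
    by move=> dlr; rewrite ltr_norml; apply/andP; split; lra.
  by rewrite enormZ d1 mulr1 gtr0_norm ?ltrDl ?addr_gt0// divr_gt0.
have mU := open_measurable_rV oU.
have mB := @measurable_eball R n r.
have UO0 : lam (U `\` O0) = 0%E.
  have := full _ Oc1.
  rewrite -(lebesgue_rV_shift (- (dl *: d))); last first.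
    by apply: measurableD => //; exact: measurable_preimage_shift_rV.
  apply: subset_measure0; [exact: measurableD| |].
    apply: measurable_preimage_shift_rV; apply: measurableD => //.
    exact: measurable_preimage_shift_rV.
  by move=> x [[B1x _] O0x]; split => //=; rewrite addrA subrK.
have UBO : lam (U `&` O0) = lam U.
  by rewrite [RHS](measureDI _ mU mO0) [X in (X + _)%E]UO0 add0e.
have BO : lam (eball r `&` O0) = lam (eball r).
  by rewrite [RHS](measureDI _ mB mO0) [X in (X + _)%E](full _ Oc0) add0e.
(* Up to null sets [O0] contains the first ball and the disjoint crescent, yet has only the mass of
   the ball. *)
have : (lam (eball r) + lam U <= lam O0)%E.
  rewrite -[X in (X + _)%E]BO -[X in (_ + X)%E]UBO -measureU.
  - apply: le_measure; rewrite ?inE//; last by move=> x [[]|[]].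
    by apply: measurableU; exact: measurableI.
  - exact: measurableI.
  - exact: measurableI.
  - apply/seteqP; split => // x [[Bx _] [[_ Ux] _]].
    by move: Ux; rewrite /= ltNge ltW.
rewrite lamO0 -[X in (_ <= X)%E]adde0 leeD2lE; last first.
  by rewrite lebesgue_rV_eball// ltW.
by rewrite leNgt U0.
Qed.

(** The open ball is the countable union of the smaller concentric balls, so the missing mass cannot
    all sit at the boundary sphere, where the kernel would give no gain. *)
Lemma exists_smaller_ball (A : set 'rV[R]_n) (r : R) : measurable A -> 0 < r ->
  (0 < lam (eball r `\` A))%E ->
  exists r', [/\ 0 < r', r' < r & (0 < lam (eball r' `\` A))%E].
Proof.
move=> mA r0 rA; apply: contrapT => /forallNP H.
pose rk (k : nat) : R := r - r / k.+1%:R.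
have k0 k : lam (eball (rk k) `\` A) = 0%E.
  have [rk0|rk0] := leP (rk k) 0.
    rewrite (_ : _ `\` _ = set0) ?measure0//; apply/seteqP; split => // x [xr _].
    by move: (le_lt_trans (enorm_ge0 x) xr); rewrite ltNge rk0.
  apply: contrapT => ne0; apply: (H (rk k)); split => //.
    by rewrite /rk ltrBlDr ltrDl divr_gt0.
  by rewrite lt0e measure_ge0 andbT; exact/eqP.
have sub : eball r `\` A `<=` \bigcup_k (eball (rk k) `\` A).
  move=> x [xr Ax].
  have rx0 : 0 < (r - enorm x) / r by rewrite divr_gt0// subr_gt0.
  have [k _ /(_ _ (leqnn k)) /= kx] := near_infty_natSinv_lt (PosNum rx0).
  exists k => //; split => //; rewrite /eball/= /rk ltrBrDl -ltrBrDr.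
  by rewrite mulrC -ltr_pdivlMr.
have mD k : measurable (eball (rk k) `\` A) by apply: measurableD => //; exact: measurable_eball.
have : lam (eball r `\` A) = 0%E.
  apply: (subset_measure0 _ _ sub); first by apply: measurableD => //; exact: measurable_eball.
    exact: bigcup_measurable.
  apply/negligibleP; first exact: bigcup_measurable.
  by apply: negligible_bigcup => k; exact: (iffRL (negligibleP _ (mD k)) (k0 k)).
by move=> Z; move: rA; rewrite Z ltxx.
Qed.

End geometry.

(** * The inequality for a small bump *)

(** At e = 0 the terms in [m'] cancel and the difference is (r'^(-s) - r^(-s)) m > 0; the rest is
    continuity in e. *)
Lemma powR_gap (R : realType) (s r r' m m' : R) :
  0 < s -> 0 < r' -> r' < r -> 0 < m -> 0 <= m' ->
  \forall e \near (0 : R), (r - e) `^ (- s) * (m + m') <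
    (r' + e) `^ (- s) * m + (r + e) `^ (- s) * m'.
Proof.
move=> s0 r'0 r'r m0 m'0; have r0 : 0 < r by exact: lt_trans r'r.
have cP (q : R -> R) : continuous q -> 0 < q 0 ->
    (q e) `^ (- s) @[e --> (0 : R)] --> (q 0) `^ (- s).
  move=> cq q0; apply: (@continuous_comp _ _ _ q (fun t => t `^ (- s)) 0); first exact: cq.
  apply/differentiable_continuous/derivable1_diffP.
  by apply: derivable_powR; rewrite in_itv/= q0.
have ca (a b : R) : continuous (fun e : R => a + b * e).
  move=> e; have FF : Filter (nbhs e) by exact: nbhs_filter.
  apply: (@cvgD _ R^o _ (nbhs e)); first exact: cvg_cst.
  by apply: (@cvgM _ _ (nbhs e)); [exact: cvg_cst|exact: cvg_id].
pose g e := (r' + 1 * e) `^ (- s) * m + (r + 1 * e) `^ (- s) * m' -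
  (r + (-1) * e) `^ (- s) * (m + m').
have cg : g e @[e --> (0 : R)] --> g 0.
  have c1 := cP (fun e => r' + 1 * e) (ca _ _).
  have c2 := cP (fun e => r + 1 * e) (ca _ _).
  have c3 := cP (fun e => r + (-1) * e) (ca _ _).
  rewrite !mulr0 !addr0 in c1 c2 c3.
  have c1' : (r' + 1 * e) `^ (- s) * m @[e --> (0 : R)] --> r' `^ (- s) * m.
    by apply: cvgMr_tmp; exact: c1.
  have c2' : (r + 1 * e) `^ (- s) * m' @[e --> (0 : R)] --> r `^ (- s) * m'.
    by apply: cvgMr_tmp; exact: c2.
  have c3' : (r + (-1) * e) `^ (- s) * (m + m') @[e --> (0 : R)] -->
      r `^ (- s) * (m + m').
    by apply: cvgMr_tmp; exact: c3.
  rewrite (_ : g 0 = r' `^ (- s) * m + r `^ (- s) * m' - r `^ (- s) * (m + m')).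
    exact: (cvgB (cvgD c1' c2') c3').
  by rewrite /g !mulr0 !addr0.
have g0 : 0 < g 0.
  rewrite /g !mulr0 !addr0 mulrDr opprD addrACA subrr addr0 -mulrBl mulr_gt0// subr_gt0.
  rewrite !powRN ltf_pV2 ?posrE ?powR_gt0//.
  by apply: (gt0_ltr_powR s0); rewrite ?nnegrE ?(ltW r'0) ?(ltW r0).
near=> e.
have : 0 < g e by near: e; exact: (cvgr_gt _ cg).
by rewrite /g !mul1r mulN1r subr_gt0.
Unshelve. all: by end_near. Qed.

Section main.
Context {R : realType} {n : nat}.
Hypothesis n0 : (0 < n)%N.
Notation lam := (lebesgue_rV R n).

Lemma integral_bump_powR (e p : R) : 0 < e -> 0 < p ->
  (0 < \int[lam]_x (bump e x `^ p)%:E < +oo)%E.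
Proof.
move=> e0 p0.
have mw : measurable_fun setT (fun x : 'rV[R]_n => (bump e x `^ p)%:E).
  apply/measurable_EFinP; apply: (measurableT_comp (measurable_powR _)).
  exact: measurable_bump.
have w0 (x : 'rV[R]_n) : (0 <= (bump e x `^ p)%:E)%E by rewrite lee_fin powR_ge0.
apply/andP; split.
  rewrite lt0e integral_ge0// andbT; apply/eqP => I0.
  have : (\int[lam]_x `|(bump e x `^ p)%:E| = 0)%E.
    by rewrite -[RHS]I0; apply: eq_integral => x _; rewrite gee0_abs.
  move/(ae_eq_integral_abs lam measurableT mw).
  move=> [N [mN N0 sub]].
  have : (lam (eball e) <= lam N)%E.
    apply: le_measure; rewrite ?inE//; first exact: measurable_eball.
    move=> x xe; apply: sub => /= /(_ I) [] /eqP.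
    by rewrite powR_eq0 gt_eqF ?bump_gt0// ltW.
  rewrite N0 leNgt lebesgue_rV_open_gt0//; first exact: open_eball.
  by exists 0; rewrite /eball/= enorm0.
apply: (@le_lt_trans _ _ (\int[lam]_x (\1_(eball e) x)%:E)%E).
  apply: ge0_le_integral => //.
    by apply/measurable_EFinP; apply: measurable_indic; exact: measurable_eball.
  move=> x _; rewrite lee_fin indicE; case: (boolP (_ \in _)); rewrite ?inE /eball/= => xe.
    rewrite -[leRHS](_ : 1 `^ p = 1); last by rewrite powR1.
    by apply: ge0_ler_powR; rewrite ?nnegrE ?(ltW p0) ?bump_ge0// flat0_le1.
  move/negP: xe; rewrite inE/= => /negP; rewrite -leNgt => xe.
  by rewrite bump_eq0 ?powR0 ?gt_eqF// ltW.
rewrite integral_indic//; last exact: measurable_eball.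
by rewrite setIT [X in (X < _)%E]lebesgue_rV_eball// ?ltry// ltW.
Qed.

Section bump_kernel.
Variables (s p e : R).
Hypotheses (s0 : 0 < s) (p0 : 0 < p) (e0 : 0 < e).
Notation K := (gagliardo_kernel s p (@bump R n e)).

(** The bump vanishes at [y], and any [x] where it is positive is at distance at least [r - e] from
    [y]. *)
Lemma gagliardo_kernel_bump_le r x y : e < r -> r <= enorm y ->
  K (x, y) <= (r - e) `^ (- s) * bump e x `^ p.
Proof.
move=> er ry; rewrite /gagliardo_kernel/= (bump_eq0 (ltW e0) (le_trans (ltW er) ry)).
rewrite subr0 ger0_norm ?bump_ge0// [leRHS]mulrC -powRN.
have [xe|ex] := ltP (enorm x) e; last first.
  by rewrite (bump_eq0 (ltW e0) ex) powR0 ?gt_eqF// !mul0r.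
rewrite ler_wpM2l ?powR_ge0// !powRN.
have re : 0 < r - e by rewrite subr_gt0.
have rexy : r - e <= enorm (x - y).
  rewrite lerBlDr; apply: (le_trans ry); apply: (@le_trans _ _ (enorm (y - x) + enorm x)).
    by have := enorm_triangle (y - x) x; rewrite subrK.
  by rewrite enormBC lerD2l ltW.
rewrite lef_pV2 ?posrE ?powR_gt0 ?(lt_le_trans re)//.
apply: ge0_ler_powR; rewrite ?nnegrE ?enorm_ge0 ?(ltW s0) ?(ltW re)//.
Qed.

Lemma gagliardo_kernel_bump_ge rho x y : x != y -> e <= enorm y -> enorm y <= rho ->
  (rho + e) `^ (- s) * bump e x `^ p <= K (x, y).
Proof.
move=> xy ey yr; rewrite /gagliardo_kernel/= (bump_eq0 (ltW e0) ey).
rewrite subr0 ger0_norm ?bump_ge0// [leLHS]mulrC -powRN.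
have [xe|ex] := ltP (enorm x) e; last first.
  by rewrite (bump_eq0 (ltW e0) ex) powR0 ?gt_eqF// !mul0r.
rewrite ler_wpM2l ?powR_ge0// !powRN.
have xy0 : 0 < enorm (x - y).
  rewrite lt_neqAle enorm_ge0 andbT eq_sym; apply: contra xy => /eqP/enorm_eq0/eqP.
  by rewrite subr_eq0.
have re : 0 < rho + e by rewrite ltr_wpDl// (le_trans (enorm_ge0 y)).
rewrite lef_pV2 ?posrE ?powR_gt0//.
apply: ge0_ler_powR; rewrite ?nnegrE ?enorm_ge0 ?(ltW s0) ?(ltW re)//.
apply: (le_trans (enorm_triangle _ _)); rewrite enormN addrC lerD// ltW//.
Qed.

End bump_kernel.

(* The mass of [O] lying outside [eball r] is farther away from the bump than
   the mass of [eball r] lying outside [O]. *)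
Lemma gagliardo_bump_lt (sigma p r r' e : R) (O : set 'rV[R]_n) :
  0 < sigma -> sigma < 1 -> 0 < p -> 0 < r' -> r' < r -> 0 < e -> e < r ->
  measurable O -> lam O = lam (eball r) ->
  eball e `<=` O ->
  let s := n%:R + sigma * p in
  let m := fine (lam (eball r' `\` O)) in
  let m' := fine (lam ((eball r `\` O) `\` eball r')) in
  (r - e) `^ (- s) * (m + m') < (r' + e) `^ (- s) * m + (r + e) `^ (- s) * m' ->
  (gagliardo sigma p O (bump e) < gagliardo sigma p (eball r : set 'rV[R]_n) (bump e))%E.
Proof.
move=> sg0 sg1 p0 r'0 r'r e0 er mO Or eO s m m' gap.
have r0 : 0 < r by exact: lt_trans r'r.
have s0 : 0 < s by rewrite ltr_wpDl// mulr_gt0.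
have mB r := @measurable_eball R n r.
pose D := eball r' `\` O; pose E := (eball r `\` O) `\` eball r'.
have mD : measurable D by exact: measurableD.
have mQ : measurable (eball r `\` O) by exact: measurableD.
have mE : measurable E by exact: measurableD.
have lamB : (lam (eball r) < +oo)%E by rewrite lebesgue_rV_eball ?ltry// ltW.
have DB : D `<=` eball r by move=> x [xr' _]; exact: lt_trans r'r.
have EB : E `<=` eball r by move=> x [[]].
have fin A : measurable A -> A `<=` eball r -> lam A = (fine (lam A))%:E.
  move=> mA AB; rewrite fineK// ge0_fin_numE//; apply: le_lt_trans lamB.
  by apply: le_measure; rewrite ?inE.
pose w (x : 'rV[R]_n) := bump e x `^ p.
(* The missing part of the ball is split at radius r': points of [D] are within [r' + e] of the
   points where the bump is positive, those of [E] within [r + e]. *)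
pose h (x : 'rV[R]_n) := (r' + e) `^ (- s) * \1_D x + (r + e) `^ (- s) * \1_E x.
have w0 x : 0 <= w x by exact: powR_ge0.
have wout x : e <= enorm x -> w x = 0.
  by move=> ex; rewrite /w bump_eq0 ?powR0 ?gt_eqF// ltW.
have mi (A : set 'rV[R]_n) : measurable A -> measurable_fun setT (\1_A : _ -> R).
  by move=> mA; exact: measurable_indic.
have h0 x : 0 <= h x by rewrite addr_ge0// mulr_ge0// powR_ge0.
have hin x : ~ (eball r `\` O) x -> h x = 0.
  move=> Qx; rewrite /h !indicE !memNset ?mulr0 ?addr0//; first by case=> /Qx.
  by move=> [xr' Ox]; apply: Qx; split => //; exact: lt_trans r'r.
rewrite !gagliardoE -/s.
apply: (@integral_double_lt _ _ _ _ _ _ _ w h ((r - e) `^ (- s))) => //.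
- by apply: measurable_gagliardo_kernel; exact: measurable_bump.
- by apply: (measurableT_comp (measurable_powR _)); exact: measurable_bump.
- by apply: measurable_funD; apply: measurable_funM => //; exact: mi.
- by move=> z; exact: gagliardo_kernel_ge0.
- exact: powR_ge0.
- move=> x xr; apply: wout; rewrite (le_trans (ltW er))// leNgt.
  exact/negP.
- by move=> x xr; apply: hin => -[].
- move=> x y Ox Oy.
  have KC0 : 0 <= gagliardo_kernel s p (bump e) (x, y) *
      \1_((O `&` eball r) `*` (O `&` eball r)) (x, y).
    by rewrite mulr_ge0// gagliardo_kernel_ge0.
  have kw0 (A : set 'rV[R]_n) a b : 0 <= (r - e) `^ (- s) * (w a * \1_A b).
    by rewrite mulr_ge0 ?powR_ge0// mulr_ge0.
  (* If one point is outside the ball, the bump vanishes there and a single cross term dominates the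
     kernel; otherwise the pair lies in the common square. *)
  have [xr|xr] := ltP (enorm x) r; last first.
    rewrite -[leLHS]add0r lerD// -[leLHS]add0r lerD//.
    rewrite gagliardo_kernelC [\1__ x]indicE mem_set ?mul1r; last first.
      by split => //; apply/negP; rewrite -leNgt.
    exact: gagliardo_kernel_bump_le.
  have [yr|yr] := ltP (enorm y) r; last first.
    rewrite -[leLHS]add0r lerD// -[leLHS]addr0 lerD//; last by rewrite [\1__ _ * _]mulrC.
    rewrite [\1__ y]indicE mem_set ?mulr1; last first.
      by split => //; apply/negP; rewrite -leNgt.
    exact: gagliardo_kernel_bump_le.
  rewrite [X in _ * X + _]indicE mem_set// mulr1 lerDl addr_ge0//.
  by rewrite [\1__ _ * _]mulrC.
- move=> x y xr yr.
  have notO z : ~ O z -> e <= enorm z by move=> Oz; rewrite leNgt; apply/negP => /eO.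
  have hO z : O z -> h z = 0 by move=> Oz; apply: hin => -[].
  have hK a b : a != b -> eball r b -> ~ O b ->
      w a * h b <= gagliardo_kernel s p (bump e) (a, b).
    move=> ab br Ob; rewrite mulrC.
    have [br'|br'] := ltP (enorm b) r'.
      rewrite /h !indicE mem_set// memNset ?mulr1 ?mulr0 ?addr0; last by case=> _ /(_ br').
      by apply: gagliardo_kernel_bump_ge => //; [exact: notO|exact: ltW].
    rewrite /h !indicE memNset; last by move=> [+ _]; rewrite /eball/= ltNge br'.
    rewrite mem_set; last by split => //; apply/negP; rewrite -leNgt.
    rewrite mulr1 mulr0 add0r.
    by apply: gagliardo_kernel_bump_ge => //; [exact: notO|exact: ltW].
  (* The bump vanishes off [O] and [h] vanishes on [O], so at most one of the three summands is
     nonzero in each case. *)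
  have [Ox|Ox] := pselect (O x); have [Oy|Oy] := pselect (O y).
  + by rewrite (hO _ Ox) (hO _ Oy) mulr0 mul0r !addr0 ler_piMr ?gagliardo_kernel_ge0//.
  + rewrite (hO _ Ox) mul0r addr0 indicE memNset ?mulr0 ?add0r; last by move=> -[_ []].
    by apply: hK => //; apply/eqP => xy; apply: Oy; rewrite -xy.
  + rewrite (hO _ Oy) mulr0 add0r indicE memNset ?mulr0 ?add0r; last by move=> -[[]].
    rewrite mulrC gagliardo_kernelC.
    by apply: hK => //; apply/eqP => xy; apply: Ox; rewrite -xy.
  + rewrite (wout _ (notO _ Ox)) (wout _ (notO _ Oy)) mulr0 mul0r !addr0.
    by rewrite indicE memNset ?mulr0 ?gagliardo_kernel_ge0// => -[[]].
- have [L L0 HL] := @bump_lipschitz R n e r.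
  apply: (@gagliardo_kernel_integral_ltoo _ _ sigma p r L) => //.
  + exact: measurable_bump.
  + exact: measurableI.
  + by move=> x y [_ xr] [_ yr]; exact: HL.
- by have /andP[] := integral_bump_powR e0 p0.
- by have /andP[] := integral_bump_powR e0 p0.
- have EI (A : set 'rV[R]_n) (k : R) : 0 <= k -> measurable A -> A `<=` eball r ->
      (\int[lam]_x (k * \1_A x)%:E = (k * fine (lam A))%:E)%E.
    move=> k0 mA AB; under eq_integral do rewrite EFinM.
    rewrite ge0_integralZl ?lee_fin//; last by apply/measurable_EFinP; exact: mi.
    by rewrite integral_indic// setIT EFinM -fin.
  under eq_integral do rewrite EFinD.
  rewrite ge0_integralD//; last first.
  + by apply/measurable_EFinP; apply: measurable_funM => //; exact: mi.
  + by move=> x _; rewrite lee_fin mulr_ge0 ?powR_ge0.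
  + by apply/measurable_EFinP; apply: measurable_funM => //; exact: mi.
  + by move=> x _; rewrite lee_fin mulr_ge0 ?powR_ge0.
  rewrite !EI ?powR_ge0// -EFinD.
  (* Equal volumes give [O] outside the ball the mass of the ball outside [O], which is m + m'; what
     remains is [gap]. *)
  rewrite lebesgue_setD_eq// ?Or//.
  rewrite (measureDI _ mQ (mB r')).
  rewrite (_ : (eball r `\` O) `&` eball r' = D); last first.
    apply/seteqP; split => x [] => [[_ Ox] xr'|xr' Ox]; first by split.
    by split => //; split => //; exact: lt_trans r'r.
  rewrite [X in (_ * (X + _))%E]fin// [X in (_ * (_ + X))%E]fin//.
  rewrite -EFinD -EFinM lte_fin.
  by rewrite [X in _ * X < _]addrC; exact: gap.
Qed.

End main.

Unset Implicit Arguments.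

Theorem theorem1p1 (R : realType) (n : nat) (Omega : set 'rV[R]_n)
    (sigma p : R) :
  (0 < n)%N ->
  open Omega -> Omega !=set0 -> (lebesgue_rV R n Omega < +oo)%E ->
  0 < sigma -> sigma < 1 -> 0 < p ->
  exists u : 'rV[R]_n -> R,
    [/\ Ccoo Omega u, (forall x, 0 <= u x) &
      (gagliardo sigma p Omega u <
       gagliardo sigma p (sym_rearr Omega) (fine \o sym_decr_rearr u))%E].
Proof.
move=> n0 oO O0 Ooo sg0 sg1 p0.
have a0 := @alpha_gt0 R n.
have lO0 := lebesgue_rV_open_gt0 oO O0.
have lOfin : lebesgue_rV R n Omega \is a fin_num by rewrite ge0_fin_numE.
(* The radius written in [sym_rearr], so that [sym_rearr Omega] is [eball r] by mere unfolding when
   [gagliardo_bump_lt] is applied. *)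
pose r := (fine (lebesgue_rV R n Omega) / alpha R n) `^ n%:R^-1.
have q0 : 0 < fine (lebesgue_rV R n Omega) / alpha R n.
  by rewrite divr_gt0// fine_gt0// lO0.
have r0 : 0 < r by rewrite powR_gt0.
have Or : lebesgue_rV R n Omega = lebesgue_rV R n (eball r).
  rewrite lebesgue_rV_eball ?(ltW r0)// -powR_mulrn ?(ltW r0)// /r -powRrM.
  rewrite mulVf ?pnatr_eq0 -?lt0n// powRr1 ?(ltW q0)//.
  by rewrite mulrC divfK ?gt_eqF// fineK.
have [c Oc Bc] := exists_center_not_ball n0 oO O0 r0 Or.
set O := (fun x => x + c) @^-1` Omega in Bc.
have mO : measurable O by exact: measurable_preimage_shift_rV (open_measurable_rV oO).
have [r' [r'0 r'r Dr']] := exists_smaller_ball mO r0 Bc.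
have mB t := @measurable_eball R n t.
pose D := eball r' `\` O; pose E := (eball r `\` O) `\` eball r'.
have fin A : measurable A -> A `<=` eball r -> lebesgue_rV R n A \is a fin_num.
  move=> mA AB; rewrite ge0_fin_numE//; apply: (@le_lt_trans _ _ (lebesgue_rV R n (eball r))).
    by apply: le_measure; rewrite ?inE.
  by rewrite lebesgue_rV_eball ?ltry// ltW.
have m0 : 0 < fine (lebesgue_rV R n D).
  rewrite fine_gt0// Dr'/= -ge0_fin_numE//; apply: fin.
    exact: measurableD.
  by move=> x [xr' _]; exact: lt_trans r'r.
have m'0 : 0 <= fine (lebesgue_rV R n E) by rewrite fine_ge0.
have s0 : 0 < n%:R + sigma * p by rewrite ltr_wpDl// mulr_gt0.
have /nbhs_ballP[d /= d0 dO] : nbhs c Omega by exact: open_nbhs_nbhs.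
have [e [e0 er ed gap]] : exists e : R, [/\ 0 < e, e < r, e < d &
    (r - e) `^ (- (n%:R + sigma * p)) *
      (fine (lebesgue_rV R n D) + fine (lebesgue_rV R n E)) <
    (r' + e) `^ (- (n%:R + sigma * p)) * fine (lebesgue_rV R n D) +
    (r + e) `^ (- (n%:R + sigma * p)) * fine (lebesgue_rV R n E)].
  have /nbhs_ballP[t /= t0 tP] := powR_gap s0 r'0 r'r m0 m'0.
  (* Smallness for three purposes: [t] for the gap, [r] to fit the bump in the ball, [d] to fit its
     support in [Omega]. *)
  pose e := Num.min t (Num.min r d) / 2.
  have min0 : 0 < Num.min t (Num.min r d) by rewrite !lt_min t0 r0.
  have e0 : 0 < e by rewrite divr_gt0.
  have : e < Num.min t (Num.min r d) by rewrite /e ltr_pdivrMr// mulr2n mulrDr mulr1 ltrDl.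
  rewrite !lt_min => /and3P[et er ed]; exists e; split => //.
  by apply: tP; rewrite /ball/= sub0r normrN gtr0_norm.
have ballO x : enorm (x - c) <= e -> Omega x.
  (* The library's balls are cubes, and coordinates are bounded by the Euclidean norm, so the closed
     Euclidean ball of radius e < d is contained in the one given by [dO]. *)
  move=> xe; apply: dO; split => // i j; rewrite [i]ord1 /ball/= distrC.
  have := coord_le_enorm (x - c) j; rewrite !mxE => h.
  exact: le_lt_trans (le_trans h xe) ed.
exists (fun x => bump e (x - c)); split.
- by apply: Ccoo_bump => //; exact: ltW.
- by move=> x; exact: bump_ge0.
rewrite (gagliardo_shift _ _ _ (open_measurable_rV oO) (@measurable_bump R n e)).
rewrite (_ : fine \o _ = bump e); last first.
  by apply/funext => x; rewrite /= sym_decr_rearr_bump.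
apply: (gagliardo_bump_lt n0 sg0 sg1 p0 r'0 r'r e0 er mO _ _ gap).
  by rewrite /O lebesgue_rV_shift//; exact: open_measurable_rV.
by move=> x xe; apply: ballO; rewrite addrK ltW.
Qed.
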